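(* Let $\psi\in(0,\pi/2]$, $m,q\in\mathbb{N}$, and let $r$ be an $\mathcal{A}(\psi,m)$-stable rational function which is an approximation of order $q$ to the exponential $e^{-z}$, with $|r(\infty)|=1$. Then for every sequence $(\alpha_n)_{n\ge1}\subset(0,\infty)$ with $\lim_{n\to\infty}\alpha_n=0$ and all $\theta\in[0,\pi/2)$ and $s\in[0,mq/(m+1))$, there exist a complex Banach space $\mathcal{X}$, an operator $\mathcal{A}\in\operatorname{Sect}(\theta)$ on $\mathcal{X}$, a vector $x\in\operatorname{dom}(\mathcal{A}^s)$ and a constant $C=C(\theta)>0$ such that $$\|e^{-\mathcal{A}}x-r^n(\mathcal{A}/n)x\|\ge C\,\alpha_n\,n^{-(1+m^{-1})s},\qquad n\in\mathbb{N}.$$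
   Context: $\mathbb{N}=\{1,2,\dots\}$. For $\alpha\in(0,\pi)$, $\Sigma_\alpha=\{\lambda\in\mathbb{C}\setminus\{0\}:|\arg\lambda|<\alpha\}$; put $\overline{\Sigma}_0=[0,\infty)$. Rational functions. A rational function $r$ is $\mathcal{A}(\psi)$-stable if $|r(\lambda)|\le1$ for all $\lambda\in\Sigma_\psi$. If $r$ is non-constant and $\mathcal{A}(\psi)$-stable, then $r(\infty)=\lim_{z\to\infty}r(z)$ exists in $\mathbb{C}$ with $|r(\infty)|\le1$, and there are $a\in\mathbb{C}\setminus\{0\}$ and $m\in\mathbb{N}$ with $r(z)=r(\infty)-a z^{-m}+O(|z|^{-(m+1)})$ as $z\to\infty$; in this case $r$ is called $\mathcal{A}(\psi,m)$-stable. $r$ is an approximation of order $q\in\mathbb{N}$ to $e^{-z}$ if $e^{-z}-r(z)=O(|z|^{q+1})$ as $z\to0$. Operators. For $\theta\in[0,\pi)$, a closed densely defined operator $A$ on a Banach space belongs to $\operatorname{Sect}(\theta)$ if $\sigma(A)\subset\overline{\Sigma}_\theta$ and $\sup\{\|\lambda(\lambda+A)^{-1}\|:\lambda\in\Sigma_{\pi-\vartheta}\}<\infty$ for every $\vartheta\in(\theta,\pi)$. If $\theta<\pi/2$ then $-A$ generates a bounded holomorphic $C_0$-semigroup $(e^{-tA})_{t\ge0}$. $A^s$ ($s\ge0$) denotes the usual fractional power of the sectorial operator $A$, with $A^0=I$. For a rational function $r$ that is finite at infinity and an operator $B$ such that no pole of $r$ lies in $\sigma(B)$, $r(B)$ is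 the bounded operator given by the natural definition for rational functions (via resolvents and partial fractions), and $r^n(B)=(r(B))^n$; the existence assertion includes that $r(\mathcal{A}/n)$ is defined for every $n\in\mathbb{N}$. $C=C(\theta)$ means that $C$ may depend on $\theta$ and on $r$ and its parameters. *)

(* Defs.v *)
From Stdlib Require Export Reals List.
From Coquelicot Require Export Coquelicot.
Open Scope R_scope.

Definition Cexp (z : C) : C := (exp (Re z) * cos (Im z), exp (Re z) * sin (Im z)).

Definition polar (rho phi : R) : C := (rho * cos phi, rho * sin phi).

(* For [0 < alpha <= PI] this is [z <> 0] and [|arg z| < alpha]. *)
Definition sector (alpha : R) (z : C) : Prop :=
  exists rho phi : R, 0 < rho /\ Rabs phi < alpha /\ z = polar rho phi.

(* For [0 < alpha < PI] the closure of [sector alpha]; for [alpha = 0] the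
   half-line [0, oo). *)
Definition closed_sector (alpha : R) (z : C) : Prop :=
  exists rho phi : R, 0 <= rho /\ Rabs phi <= alpha /\ z = polar rho phi.

Definition at_Cinfty (P : C -> Prop) : Prop :=
  exists M : R, forall z : C, M < Cmod z -> P z.

(* Coefficients in increasing degree. *)
Definition peval (p : list C) (z : C) : C :=
  fold_right (fun a v => (a + z * v)%C) (RtoC 0) p.

(* Numerator and denominator without common zero, so that the poles are exactly
   the zeros of the denominator. *)
Record ratfun := Ratfun {
  num : list C;
  den : list C;
  den_neq0 : exists z : C, peval den z <> RtoC 0;
  reduced : forall z : C, ~ (peval num z = RtoC 0 /\ peval den z = RtoC 0)
}.

Definition reval (r : ratfun) (z : C) : C := (peval (num r) z / peval (den r) z)%C.

Definition is_pole (r : ratfun) (z : C) : Prop := peval (den r) z = RtoC 0.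

Definition A_stable (psi : R) (r : ratfun) : Prop :=
  forall z : C, sector psi z -> ~ is_pole r z /\ Cmod (reval r z) <= 1.

Definition is_constant (r : ratfun) : Prop :=
  exists c : C, forall z : C, ~ is_pole r z -> reval r z = c.

Definition value_at_infinity (r : ratfun) (c : C) : Prop :=
  filterlim (reval r) at_Cinfty (locally c).

Definition A_stable_order (psi : R) (m : nat) (r : ratfun) : Prop :=
  ~ is_constant r /\ A_stable psi r /\
  exists c a : C, value_at_infinity r c /\ a <> RtoC 0 /\
  exists K : R, at_Cinfty (fun z =>
    Cmod (reval r z - (c - a / Cpow z m))%C <= K / Cmod z ^ (m + 1)).

Definition approx_exp_order (q : nat) (r : ratfun) : Prop :=
  exists K : R, locally (RtoC 0) (fun z =>
    Cmod (Cexp (- z) - reval r z)%C <= K * Cmod z ^ (q + 1)).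

(* Coquelicot integrates functions with values in real normed modules. *)
Section RestrictScalars.
Variable V : NormedModule C_AbsRing.

Definition Rscal (a : R) (v : V) : V := scal (RtoC a : C_AbsRing) v.

Lemma Rscal_assoc (a b : R_Ring) (v : V) : Rscal a (Rscal b v) = Rscal (mult a b) v.
Proof.
  unfold Rscal; rewrite scal_assoc; apply f_equal2; trivial.
  symmetry; apply (RtoC_mult a b).
Qed.

Lemma Rscal_one (v : V) : Rscal (one : R_Ring) v = v.
Proof. exact (scal_one v). Qed.

Lemma Rscal_distr_l (a : R_Ring) (u v : V) :
  Rscal a (plus u v) = plus (Rscal a u) (Rscal a v).
Proof. exact (scal_distr_l _ u v). Qed.

Lemma Rscal_distr_r (a b : R_Ring) (v : V) :
  Rscal (plus a b) v = plus (Rscal a v) (Rscal b v).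
Proof.
  unfold Rscal; transitivity (scal (plus (RtoC a : C_AbsRing) (RtoC b)) v).
  - apply f_equal2; trivial; exact (RtoC_plus a b).
  - exact (scal_distr_r (RtoC a : C_AbsRing) (RtoC b) v).
Qed.

Definition restrict_ModuleSpace_class : ModuleSpace.class_of R_Ring V :=
  ModuleSpace.Class R_Ring V (AbelianGroup.class V)
    (ModuleSpace.Mixin R_Ring (AbelianGroup.Pack V (AbelianGroup.class V) V) Rscal
       Rscal_assoc Rscal_one Rscal_distr_l Rscal_distr_r).

Definition restrict_Aux : NormedModuleAux R_AbsRing :=
  NormedModuleAux.Pack R_AbsRing V
    (NormedModuleAux.Class R_AbsRing V restrict_ModuleSpace_class (UniformSpace.class V)) V.

Lemma restrict_norm_scal (a : R) (v : V) : norm (Rscal a v) <= Rabs a * norm v.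
Proof. unfold Rscal; rewrite <- Cmod_R; exact (norm_scal (RtoC a : C_AbsRing) v). Qed.

Definition restrict_mixin : NormedModule.mixin_of R_AbsRing restrict_Aux :=
  NormedModule.Mixin R_AbsRing restrict_Aux (@norm C_AbsRing V) (@norm_factor C_AbsRing V)
    (@norm_triangle C_AbsRing V) restrict_norm_scal
    (@norm_compat1 C_AbsRing V) (@norm_compat2 C_AbsRing V) (@norm_eq_zero C_AbsRing V).

Definition restrict_scalars : NormedModule R_AbsRing :=
  NormedModule.Pack R_AbsRing V
    (NormedModule.Class R_AbsRing V (NormedModuleAux.class R_AbsRing restrict_Aux)
       restrict_mixin) V.

End RestrictScalars.

Section Operators.
Variable X : CompleteNormedModule C_AbsRing.

(* An unbounded operator is given by its graph: [A x y] reads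
   "x is in the domain of A and A x = y". *)
Definition graph := X -> X -> Prop.

Definition is_operator (A : graph) : Prop :=
  A zero zero /\
  (forall x x' y y' : X, A x y -> A x' y' -> A (plus x x') (plus y y')) /\
  (forall (c : C) (x y : X), A x y -> A (scal (c : C_AbsRing) x) (scal (c : C_AbsRing) y)) /\
  (forall x y y' : X, A x y -> A x y' -> y = y').

Definition dom (A : graph) (x : X) : Prop := exists y : X, A x y.

Definition closed_op (A : graph) : Prop :=
  closed (fun p : prod_UniformSpace X X => A (fst p) (snd p)).

Definition densely_defined (A : graph) : Prop :=
  forall (x : X) (eps : posreal), exists x' : X, ball x eps x' /\ dom A x'.

Definition closure_op (A : graph) : graph := fun x y =>
  forall eps : posreal, exists x' y' : X, ball x eps x' /\ ball y eps y' /\ A x' y'.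

Definition scal_op (c : C) (A : graph) : graph := fun x y =>
  exists w : X, A x w /\ y = scal (c : C_AbsRing) w.

Fixpoint pow_op (A : graph) (k : nat) : graph :=
  match k with
  | O => fun x y => y = x
  | S k' => fun x y => exists w : X, pow_op A k' x w /\ A w y
  end.

(* [S] is the bounded inverse [(z + A)^{-1}], defined on all of [X]. *)
Definition is_shift_inverse (A : graph) (z : C) (S : X -> X) : Prop :=
  is_linear S /\
  forall x y : X, S y = x <-> A x (minus y (scal (z : C_AbsRing) x)).

Definition spectrum (A : graph) (z : C) : Prop :=
  ~ exists S : X -> X, is_shift_inverse A (- z)%C S.

Definition Sect (theta : R) (A : graph) : Prop :=
  is_operator A /\ closed_op A /\ densely_defined A /\
  (forall z : C, spectrum A z -> closed_sector theta z) /\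
  forall vartheta : R, theta < vartheta < PI ->
    exists M : R, forall (z : C) (S : X -> X),
      sector (PI - vartheta) z -> is_shift_inverse A z S ->
      forall x : X, norm (scal (z : C_AbsRing) (S x)) <= M * norm x.

Definition C0_semigroup (T : R -> X -> X) : Prop :=
  (forall t : R, 0 <= t -> is_linear (T t)) /\
  (forall x : X, T 0 x = x) /\
  (forall (t u : R) (x : X), 0 <= t -> 0 <= u -> T (t + u) x = T t (T u x)) /\
  (forall x : X, filterlim (fun t => T t x) (at_right 0) (locally x)).

Definition generator (T : R -> X -> X) : graph := fun x y =>
  filterlim (fun t : R => scal (RtoC (/ t) : C_AbsRing) (minus (T t x) x))
    (at_right 0) (locally y).

(* A C_0-semigroup is determined by its generator; here [T t = e^{-tA}]. *)
Definition is_exp_semigroup (A : graph) (T : R -> X -> X) : Prop :=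
  C0_semigroup T /\ forall x y : X, generator T x y <-> A x (opp y).

(* Euler's beta function, B(a, b) = Gamma(a) Gamma(b) / Gamma(a + b). *)
Definition beta (a b : R) : R :=
  RInt_gen (V := R_CompleteNormedModule)
    (fun t => Rpower t (a - 1) / Rpower (1 + t) (a + b))
    (at_right 0) (Rbar_locally p_infty).

(* Balakrishnan's operator: for [k - 1 <= s < k] and [x] in dom(A^k),
     J^s x = Gamma(k) / (Gamma(s) Gamma(k - s)) *
               int_0^oo t^(s-1) [A (t + A)^{-1}]^k x dt,
   where [S t = (t + A)^{-1}], so that [A (t + A)^{-1} v = v - t S t v]. *)
Definition balakrishnan (A : graph) (s : R) : graph := fun x y =>
  exists (k : nat) (S : R -> X -> X),
    INR k - 1 <= s < INR k /\ dom (pow_op A k) x /\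
    (forall t : R, 0 < t -> is_shift_inverse A (RtoC t) (S t)) /\
    is_RInt_gen (V := restrict_scalars X)
      (fun t : R => scal (RtoC (Rpower t (s - 1)) : C_AbsRing)
         (Nat.iter k (fun v : X => minus v (scal (RtoC t : C_AbsRing) (S t v))) x))
      (at_right 0) (Rbar_locally p_infty)
      (scal (RtoC (beta s (INR k - s)) : C_AbsRing) y).

(* For a densely defined sectorial operator, A^s is the closure of J^s. *)
Definition frac_power (A : graph) (s : R) : graph := fun x y =>
  (s = 0 /\ y = x) \/ (0 < s /\ closure_op (balakrishnan A s) x y).

Record simple_fraction := SimpleFraction { coef : C; pole : C; pexp : nat }.

Definition sf_eval (u : simple_fraction) (z : C) : C :=
  (coef u / Cpow (z - pole u) (pexp u))%C.

Definition is_partial_fraction (r : ratfun) (c : C) (l : list simple_fraction) : Prop :=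
  forall z : C, ~ is_pole r z -> (forall u, In u l -> z <> pole u) ->
    reval r z = fold_right (fun u v => (sf_eval u z + v)%C) c l.

(* [T = r(B)], obtained by substituting B in a partial fraction decomposition of
   r all of whose poles lie in the resolvent set of B; [S p = (B - p)^{-1}]. Such
   a decomposition exists iff r is finite at infinity and no pole of r is in the
   spectrum of B, and T does not depend on it. *)
Definition is_rational_calculus (r : ratfun) (B : graph) (T : X -> X) : Prop :=
  exists (c : C) (l : list simple_fraction) (S : C -> X -> X),
    is_partial_fraction r c l /\
    (forall u, In u l -> is_shift_inverse B (- pole u)%C (S (pole u))) /\
    forall x : X,
      T x = fold_right
              (fun u v => plus (scal (coef u : C_AbsRing)
                                  (Nat.iter (pexp u) (S (pole u)) x)) v)
              (scal (c : C_AbsRing) x) l.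

End Operators.

Arguments dom {X} A x.
Arguments scal_op {X} c A x y.
Arguments Sect {X} theta A.
Arguments is_exp_semigroup {X} A T.
Arguments frac_power {X} A s x y.
Arguments is_rational_calculus {X} r B T.

(* Main.v *)
From mathcomp Require all_boot all_algebra complex Rstruct.
Require Import Defs.
From Stdlib Require Import Lra Lia Classical ClassicalEpsilon FunctionalExtensionality
  PropExtensionality.

(** The rate cannot be improved because, when [|r(oo)| = 1], the numerical scheme
    does not damp high frequencies: [r(z) = r(oo) - a z^(-m) + O(z^(-m-1))] gives
    [|r(x)| >= 1 - c x^(-m)] for large real [x] ([stable_lower_bound]), so that
    [|r(x)|^n] stays above 1/2 as soon as [x^m] is at least [2 c n].  The choice
    [x = kappa n^(1/m)], that is [lambda = n x = kappa n^(1+1/m)], makes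
    [|r(lambda/n)^n| >= 1/2] while [e^(-lambda) <= 1/4], for every [n >= 1]
    ([stable_step_gap]).

    These frequencies are put together in one diagonal operator.  Let [A] be the
    multiplication by [lambda_n = kappa n^(1+1/m)] on the space [c_0] of complex
    sequences tending to 0, and let [x] have the coordinates
    [alpha_n n^(-(1+1/m)s)].  The n-th coordinate of [e^(-A) x - r(A/n)^n x] has
    modulus at least [alpha_n n^(-(1+1/m)s) / 4], and the norm of [c_0] dominates
    every coordinate.  The vector [A^s x] has the coordinates [kappa^s alpha_n], and
    this is an element of [c_0] exactly because [alpha_n -> 0].  The spectrum of [A]
    is contained in the positive half-line, so [A] lies in every class Sect(theta).

    The remaining work is to check that the objects attached to [A] are the expected
    multiplication operators: the resolvents and the sectoriality bound
    ([diag_Sect]), the semigroup and its generator ([diag_is_exp_semigroup]), the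
    rational calculus ([diag_rational_calculus]), which needs the existence of a
    partial fraction decomposition of [r] ([partial_fraction_exists]), and the
    fractional power ([diag_frac_power]).  The last one rests on the scalar identity
    [int_0^oo t^(s-1) (lambda/(t+lambda))^k dt = lambda^s B(s, k-s)]; finitely
    supported vectors reduce Balakrishnan's integral to it, and the closure gives all
    other vectors. *)

(** * Roots of complex polynomials *)

Module FundamentalTheorem.
Import all_boot all_algebra complex Rstruct.
Import GRing.Theory.
Local Open Scope ring_scope.
Local Open Scope complex_scope.

(** The bijection from pairs of reals to the complex extension [R[i]] of the real
    closed field [R]. *)
Definition toC (z : C) : R[i] := fst z +i* snd z.

Lemma toC_inj : injective toC.
Proof. by move=> [a b] [c d] [-> ->]. Qed.

Lemma horner_toC (p : list C) (z : C) :
  (Poly (map toC p)).[toC z] = toC (peval p z).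
Proof.
elim: p => [|a p IH] /=; first by rewrite horner0.
rewrite horner_cons IH /=.
case: (peval p z) => [w1 w2]; case: a => a1 a2; rewrite /toC /=.
rewrite mulrC addrC.
by [].
Qed.

(** A polynomial function that is not constant has a root: [R[i]] is algebraically
    closed.  Non-constancy is expressed by values, so that vanishing leading
    coefficients are harmless. *)
Lemma peval_root (p : list C) :
  (exists z w, peval p z <> peval p w) -> exists z, peval p z = RtoC R0.
Proof.
move=> [z [w Hzw]].
case: (boolP (size (Poly (map toC p)) == 1%N)) => [/size_poly1P [c _ Hc]|].
- case: Hzw; apply: toC_inj.
  by rewrite -!horner_toC Hc !hornerC.
- move/closed_rootP => [x Hx].
  exists (complex.Re x, complex.Im x); apply: toC_inj; rewrite -horner_toC.
  have -> : toC (complex.Re x, complex.Im x) = x by case: (x).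
  exact/rootP.
Qed.
End FundamentalTheorem.

(** * Partial fractions *)

(** Division by a linear factor, with the length of the quotient to control
    inductions on the degree. *)
Lemma peval_div_linear (p : list C) (z0 : C) :
  exists p', length p' = pred (length p) /\
    forall z, peval p z = (peval p z0 + (z - z0) * peval p' z)%C.
Proof.
  induction p as [|a p IH].
  - exists nil; split; [reflexivity|]; intros z; simpl; ring.
  - destruct p as [|b p].
    + exists nil; split; [reflexivity|]; intros z; simpl; ring.
    + destruct IH as [q [Hq IH]].
      exists (peval (b :: p) z0 :: q); split.
      * simpl in *; rewrite Hq; reflexivity.
      * intros z.
        change (peval (a :: b :: p) z) with (a + z * peval (b :: p) z)%C.
        change (peval (a :: b :: p) z0) with (a + z0 * peval (b :: p) z0)%C.
        change (peval (peval (b :: p) z0 :: q) z)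
          with (peval (b :: p) z0 + z * peval q z)%C.
        rewrite (IH z); ring.
Qed.

(** The monic polynomial function with the roots [ps], listed with multiplicity. *)
Definition root_prod (ps : list C) (z : C) : C :=
  fold_right (fun u v => ((z - u) * v)%C) (RtoC 1) ps.

Lemma root_prod_eq0 (ps : list C) (z : C) : root_prod ps z = RtoC 0 <-> In z ps.
Proof.
  induction ps as [|u ps IH]; simpl.
  - split; [|tauto]. intros H; exfalso; apply C1_nz; exact H.
  - rewrite <- IH; split.
    + intros H. destruct (Ceq_dec u z) as [E|E]; [left; exact E|right].
      destruct (Ceq_dec (root_prod ps z) (RtoC 0)) as [F|F]; [exact F|].
      exfalso. revert H. apply Cmult_neq_0; [|exact F].
      intros G. apply E. symmetry. replace z with (z - u + u)%C by ring.
      rewrite G; ring.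
    + intros [E|E]; [rewrite E; ring|].
      fold (root_prod ps z) in *. rewrite E; ring.
Qed.

Lemma peval_factor (p : list C) : (exists z, peval p z <> RtoC 0) ->
  exists (c : C) (ps : list C), c <> RtoC 0 /\
    forall z, peval p z = (c * root_prod ps z)%C.
Proof.
  remember (length p) as N eqn:HN. revert p HN.
  induction N as [|N IH]; intros p HN [w Hw].
  - destruct p; [|discriminate]. elim Hw; reflexivity.
  - destruct (classic (exists z w, peval p z <> peval p w)) as [H|H].
    + destruct (FundamentalTheorem.peval_root p H) as [z0 Hz0].
      destruct (peval_div_linear p z0) as [p' [Hl Hp']].
      rewrite <- HN in Hl; simpl in Hl.
      destruct (IH p' (eq_sym Hl)) as [c [ps [Hc Hps]]].
      * exists w; intros E; apply Hw. rewrite Hp', Hz0, E; ring.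
      * exists c, (z0 :: ps); split; [exact Hc|].
        intros z; rewrite Hp', Hz0, Hps; simpl.
        fold (root_prod ps z); ring.
    + exists (peval p w), nil; split; [exact Hw|].
      intros z; simpl. rewrite Cmult_1_r.
      apply NNPP; intros E; apply H; exists z, w; exact E.
Qed.

(** The value at [z] of the constant [c] plus the simple fractions in [l]. *)
Definition sf_sum (c : C) (l : list simple_fraction) (z : C) : C :=
  fold_right (fun u v => (sf_eval u z + v)%C) c l.

(** [f] coincides off [ps] with a constant plus simple fractions whose poles lie in
    [ps].  These functions are closed under linear combinations and under division by
    [z - p] for [p] in [ps]. *)
Definition has_partial_fraction (ps : list C) (f : C -> C) : Prop :=
  exists (c : C) (l : list simple_fraction),
    (forall u, In u l -> In (pole u) ps) /\
    forall z, ~ In z ps -> f z = sf_sum c l z.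

Lemma sf_sum_app (c d : C) (l k : list simple_fraction) (z : C) :
  sf_sum (c + d) (l ++ k) z = (sf_sum c l z + sf_sum d k z)%C.
Proof.
  induction l as [|u l IH]; simpl.
  - induction k as [|v k IH]; simpl; [reflexivity|].
    unfold sf_sum in IH |- *; simpl in IH |- *; rewrite IH; ring.
  - unfold sf_sum in IH |- *; simpl; rewrite IH; ring.
Qed.

Lemma has_partial_fraction_ext ps f g :
  (forall z, ~ In z ps -> f z = g z) ->
  has_partial_fraction ps f -> has_partial_fraction ps g.
Proof.
  intros E (c & l & Hl & H); exists c, l; split; [exact Hl|].
  intros z Hz; rewrite <- E; auto.
Qed.

Lemma has_partial_fraction_const ps c : has_partial_fraction ps (fun _ => c).
Proof. exists c, nil; split; [simpl; tauto|reflexivity]. Qed.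

Lemma has_partial_fraction_sf ps u : In (pole u) ps -> has_partial_fraction ps (sf_eval u).
Proof.
  intros H; exists (RtoC 0), (u :: nil); split.
  - intros v [<-|[]]; exact H.
  - intros z _; unfold sf_sum; simpl; ring.
Qed.

Lemma has_partial_fraction_plus ps f g :
  has_partial_fraction ps f -> has_partial_fraction ps g ->
  has_partial_fraction ps (fun z => (f z + g z)%C).
Proof.
  intros (c & l & Hl & Hf) (d & k & Hk & Hg); exists (c + d)%C, (l ++ k); split.
  - intros u Hu; apply in_app_or in Hu; destruct Hu; auto.
  - intros z Hz; rewrite sf_sum_app, Hf, Hg; auto.
Qed.

Lemma has_partial_fraction_scal ps a f :
  has_partial_fraction ps f -> has_partial_fraction ps (fun z => (a * f z)%C).
Proof.
  intros (c & l & Hl & H).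
  exists (a * c)%C,
    (map (fun u => SimpleFraction (a * coef u) (pole u) (pexp u))%C l); split.
  - intros u Hu; apply in_map_iff in Hu; destruct Hu as [v [<- Hv]]; simpl; auto.
  - intros z Hz; rewrite H by exact Hz; clear.
    induction l as [|u l IH]; [reflexivity|].
    unfold sf_sum in IH |- *; simpl; rewrite <- IH.
    unfold sf_eval, Cdiv; simpl; ring.
Qed.

Lemma has_partial_fraction_incl ps qs f :
  incl ps qs -> has_partial_fraction ps f -> has_partial_fraction qs f.
Proof.
  intros Hi (c & l & Hl & H); exists c, l; split.
  - intros u Hu; apply Hi; auto.
  - intros z Hz; apply H; intros K; apply Hz; auto.
Qed.

Lemma Cminus_neq0 (a b : C) : a <> b -> (a - b)%C <> RtoC 0.
Proof.
  intros H E; apply H; replace a with (a - b + b)%C by ring; rewrite E; ring.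
Qed.

Lemma has_partial_fraction_div_linear_sf ps p a b k : In p ps -> In b ps ->
  has_partial_fraction ps (fun z => (sf_eval (SimpleFraction a b k) z / (z - p))%C).
Proof.
  intros Hp Hb; induction k as [|k IH].
  - apply (has_partial_fraction_ext ps (sf_eval (SimpleFraction a p 1)));
      [|apply has_partial_fraction_sf; exact Hp].
    intros z Hz; unfold sf_eval; simpl. field.
    apply Cminus_neq0; intros ->; auto.
  - destruct (Ceq_dec p b) as [<-|Hpb].
    + apply (has_partial_fraction_ext ps (sf_eval (SimpleFraction a p (S (S k)))));
        [|apply has_partial_fraction_sf; exact Hp].
      intros z Hz; unfold sf_eval; simpl.
      assert (E : (z - p)%C <> RtoC 0) by (apply Cminus_neq0; intros ->; auto).
      field; repeat split; auto; apply Cpow_nz; exact E.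
    + (* 1/((z-b)(z-p)) = (1/(p-b)) (1/(z-p) - 1/(z-b)) *)
      apply (has_partial_fraction_ext ps (fun z =>
        (/ (p - b) * (sf_eval (SimpleFraction a b k) z / (z - p)
           + (- (1)) * sf_eval (SimpleFraction a b (S k)) z))%C)).
      * intros z Hz; unfold sf_eval; simpl.
        assert (E : (z - p)%C <> RtoC 0) by (apply Cminus_neq0; intros ->; auto).
        assert (F : (z - b)%C <> RtoC 0) by (apply Cminus_neq0; intros ->; auto).
        assert (G : (p - b)%C <> RtoC 0) by (apply Cminus_neq0; exact Hpb).
        field; repeat split; auto. apply Cpow_nz; exact F.
      * apply has_partial_fraction_scal, has_partial_fraction_plus; [exact IH|].
        apply has_partial_fraction_scal, has_partial_fraction_sf; exact Hb.
Qed.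

Lemma has_partial_fraction_div_linear ps p f : In p ps ->
  has_partial_fraction ps f ->
  has_partial_fraction ps (fun z => (f z / (z - p))%C).
Proof.
  intros Hp (c & l & Hl & H).
  apply (has_partial_fraction_ext ps (fun z => (sf_sum c l z / (z - p))%C)).
  { intros z Hz; rewrite H by exact Hz; reflexivity. }
  clear H; induction l as [|u l IH].
  - apply (has_partial_fraction_ext ps (sf_eval (SimpleFraction c p 1)));
      [|apply has_partial_fraction_sf; exact Hp].
    intros z Hz; unfold sf_eval, sf_sum; simpl.
    field; apply Cminus_neq0; intros ->; auto.
  - apply (has_partial_fraction_ext ps (fun z =>
      (sf_eval u z / (z - p) + sf_sum c l z / (z - p))%C)).
    + intros z Hz; unfold sf_sum; simpl.
      field; apply Cminus_neq0; intros ->; auto.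
    + apply has_partial_fraction_plus.
      * destruct u as [a b k]; apply has_partial_fraction_div_linear_sf; [exact Hp|].
        apply (Hl (SimpleFraction a b k)); left; reflexivity.
      * apply IH; intros v Hv; apply Hl; right; exact Hv.
Qed.

Lemma polynomial_plus_partial_fraction (P ps : list C) :
  exists (W : list C) (g : C -> C), has_partial_fraction ps g /\
    forall z, ~ In z ps -> (peval P z / root_prod ps z = peval W z + g z)%C.
Proof.
  induction ps as [|p ps IH].
  - exists P, (fun _ => RtoC 0); split; [apply has_partial_fraction_const|].
    intros z _; simpl; field.
  - destruct IH as (W & g & Hg & H).
    destruct (peval_div_linear W p) as [W' [_ HW]].
    exists W', (fun z => (peval W p / (z - p) + g z / (z - p))%C); split.
    + apply has_partial_fraction_plus;
        (apply has_partial_fraction_div_linear; [left; reflexivity|]).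
      * apply has_partial_fraction_const.
      * apply (has_partial_fraction_incl ps); [apply incl_tl, incl_refl|exact Hg].
    + intros z Hz.
      assert (E : (z - p)%C <> RtoC 0)
        by (apply Cminus_neq0; intros ->; apply Hz; left; reflexivity).
      assert (F : ~ In z ps) by (intros F; apply Hz; right; exact F).
      assert (G : root_prod ps z <> RtoC 0) by (rewrite root_prod_eq0; exact F).
      simpl; fold (root_prod ps z).
      transitivity ((peval P z / root_prod ps z) / (z - p))%C.
      * field; split; auto.
      * rewrite H by exact F. rewrite (HW z). field; exact E.
Qed.

(** A polynomial bounded on a real half-line is constant: writing
    [W(z) = w + z W'(z)], the factor [W'] is bounded too, hence constant by
    induction, and this constant is zero. *)
Lemma peval_bounded_const (W : list C) (B X0 : R) :
  (forall x, X0 <= x -> Cmod (peval W (RtoC x)) <= B) ->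
  forall z, peval W z = peval W (RtoC 0).
Proof.
  revert B X0; induction W as [|w W IH]; intros B X0 H z; [reflexivity|].
  set (X1 := Rmax X0 1).
  assert (HX0 : X0 <= X1) by apply Rmax_l.
  assert (HX1 : 1 <= X1) by apply Rmax_r.
  assert (HW : forall x, X1 <= x -> x * Cmod (peval W (RtoC x)) <= B + Cmod w).
  { intros x Hx.
    replace (x * Cmod (peval W (RtoC x))) with (Cmod (RtoC x * peval W (RtoC x))%C)
      by (rewrite Cmod_mult, Cmod_R, Rabs_pos_eq; [reflexivity|lra]).
    replace (RtoC x * peval W (RtoC x))%C with (peval (w :: W) (RtoC x) + - w)%C
      by (simpl; ring).
    eapply Rle_trans; [apply Cmod_triangle|].
    rewrite Cmod_opp. specialize (H x); lra. }
  assert (HB : 0 <= B + Cmod w).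
  { specialize (HW X1 (Rle_refl _)). pose proof (Cmod_ge_0 (peval W (RtoC X1))). nra. }
  assert (IH' : forall z, peval W z = peval W (RtoC 0)).
  { apply (IH (B + Cmod w) X1); intros x Hx. specialize (HW x Hx).
    pose proof (Cmod_ge_0 (peval W (RtoC x))). nra. }
  assert (H0 : peval W (RtoC 0) = RtoC 0).
  { destruct (Ceq_dec (peval W (RtoC 0)) (RtoC 0)) as [E|E]; [exact E|exfalso].
    apply Cmod_gt_0 in E. set (d := Cmod (peval W (RtoC 0))) in *.
    specialize (HW (X1 + (B + Cmod w) / d)).
    rewrite IH' in HW. fold d in HW.
    assert (P : 0 <= (B + Cmod w) / d) by (apply Rle_mult_inv_pos; lra).
    assert (Q : (X1 + (B + Cmod w) / d) * d = X1 * d + (B + Cmod w)) by (field; lra).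
    rewrite Q in HW. nra. }
  simpl; rewrite IH', H0; ring.
Qed.

Lemma sf_sum_bounded c l : exists B X0, forall x, X0 <= x ->
  Cmod (sf_sum c l (RtoC x)) <= B.
Proof.
  induction l as [|u l (B & X0 & H)].
  - exists (Cmod c), 0; intros x _; apply Rle_refl.
  - exists (Cmod (coef u) + B), (Rmax X0 (Cmod (pole u) + 1)); intros x Hx.
    assert (H0 : X0 <= x) by (eapply Rle_trans; [apply Rmax_l|exact Hx]).
    assert (H1 : Cmod (pole u) + 1 <= x) by (eapply Rle_trans; [apply Rmax_r|exact Hx]).
    unfold sf_sum in *; simpl.
    eapply Rle_trans; [apply Cmod_triangle|]. apply Rplus_le_compat; [|apply H, H0].
    assert (H2 : 1 <= Cmod (RtoC x - pole u)%C).
    { pose proof (Cmod_triangle (RtoC x - pole u)%C (pole u)) as T.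
      replace (RtoC x - pole u + pole u)%C with (RtoC x) in T by ring.
      rewrite Cmod_R in T. pose proof (Rle_abs x). lra. }
    unfold sf_eval.
    assert (H3 : 1 <= Cmod (RtoC x - pole u)%C ^ pexp u) by (apply pow_R1_Rle; exact H2).
    rewrite Cmod_div, Cmod_pow.
    2: { apply Cpow_nz; intros E; rewrite E, Cmod_0 in H2; lra. }
    apply Rle_div_l; [lra|]. pose proof (Cmod_ge_0 (coef u)). nra.
Qed.

(** A rational function bounded on the positive reals has no polynomial part, so that
    it decomposes into a constant and simple fractions at its poles. *)
Lemma partial_fraction_exists (r : ratfun) (B0 : R) :
  (forall x, 0 < x -> ~ is_pole r (RtoC x) /\ Cmod (reval r (RtoC x)) <= B0) ->
  exists c l, is_partial_fraction r c l /\ forall u, In u l -> is_pole r (pole u).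
Proof.
  intros Hb.
  destruct (peval_factor (den r) (den_neq0 r)) as (d & ps & Hd & Hden).
  assert (Hpole : forall z, is_pole r z <-> In z ps).
  { intros z; unfold is_pole; rewrite Hden, <- root_prod_eq0; split.
    - intros E. replace (root_prod ps z) with (/ d * (d * root_prod ps z))%C
        by (field; exact Hd). rewrite E; ring.
    - intros ->; ring. }
  destruct (polynomial_plus_partial_fraction (num r) ps)
    as (W & g & (c & l & Hl & Hg) & H).
  assert (Hr : forall z, ~ is_pole r z ->
    reval r z = (/ d * (peval W z + sf_sum c l z))%C).
  { intros z Hz. rewrite Hpole in Hz. rewrite <- Hg, <- H by exact Hz.
    unfold reval; rewrite Hden. field. split; [|exact Hd].
    rewrite root_prod_eq0; exact Hz. }
  assert (HW : forall z, peval W z = peval W (RtoC 0)).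
  { destruct (sf_sum_bounded c l) as (B & X0 & HB).
    apply (peval_bounded_const W (Cmod d * B0 + B) (Rmax X0 1)); intros x Hx.
    assert (H0 : X0 <= x) by (eapply Rle_trans; [apply Rmax_l|exact Hx]).
    assert (H1 : 1 <= x) by (eapply Rle_trans; [apply Rmax_r|exact Hx]).
    destruct (Hb x) as [Hx1 Hx2]; [lra|].
    replace (peval W (RtoC x)) with (d * reval r (RtoC x) + - sf_sum c l (RtoC x))%C
      by (rewrite Hr by exact Hx1; field; exact Hd).
    eapply Rle_trans; [apply Cmod_triangle|].
    rewrite Cmod_opp, Cmod_mult. specialize (HB x H0).
    pose proof (Cmod_ge_0 d). nra. }
  destruct (has_partial_fraction_scal ps (/ d)%C (fun z => peval W (RtoC 0) + sf_sum c l z)%C)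
    as (c' & l' & Hl' & H').
  { apply has_partial_fraction_plus; [apply has_partial_fraction_const|].
    exists c, l; split; [exact Hl|reflexivity]. }
  exists c', l'; split.
  - intros z Hz _. rewrite Hr, HW by exact Hz. apply H'. rewrite <- Hpole; exact Hz.
  - intros u Hu; apply Hpole; auto.
Qed.

(** * The Banach space of null sequences *)

(** Convergence to zero of a complex sequence. *)
Definition vanishing (u : nat -> C) : Prop :=
  forall eps, 0 < eps -> exists N, forall n, (N <= n)%nat -> Cmod (u n) < eps.

(** The space [c_0] of complex sequences tending to zero. *)
Record c0 := C0 { term : nat -> C; term_vanishing : vanishing term }.

Lemma c0_ext (x y : c0) : (forall n, term x n = term y n) -> x = y.
Proof.
  destruct x as [u Hu], y as [v Hv]; simpl; intros H.
  assert (E : u = v) by (apply functional_extensionality; exact H).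
  subst v; f_equal; apply proof_irrelevance.
Qed.

Lemma vanishing_0 : vanishing (fun _ => RtoC 0).
Proof. intros eps H; exists 0%nat; intros; rewrite Cmod_0; exact H. Qed.

Lemma vanishing_le (u v : nat -> C) (M : R) :
  (forall n, Cmod (v n) <= M * Cmod (u n)) -> vanishing u -> vanishing v.
Proof.
  intros H Hu eps He.
  set (M' := Rabs M + 1).
  assert (HM : 0 < M') by (unfold M'; pose proof (Rabs_pos M); lra).
  destruct (Hu (eps / M')) as [N HN]; [apply Rdiv_lt_0_compat; lra|].
  exists N; intros n Hn; specialize (HN n Hn).
  apply Rlt_div_r in HN; [|exact HM].
  eapply Rle_lt_trans; [apply H|]. eapply Rle_lt_trans; [|exact HN].
  rewrite Rmult_comm. apply Rmult_le_compat_l; [apply Cmod_ge_0|].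
  unfold M'; pose proof (Rle_abs M); lra.
Qed.

Lemma vanishing_plus (u v : nat -> C) :
  vanishing u -> vanishing v -> vanishing (fun n => (u n + v n)%C).
Proof.
  intros Hu Hv eps He.
  destruct (Hu (eps / 2)) as [N HN]; [lra|].
  destruct (Hv (eps / 2)) as [P HP]; [lra|].
  exists (Nat.max N P); intros n Hn.
  specialize (HN n ltac:(lia)); specialize (HP n ltac:(lia)).
  eapply Rle_lt_trans; [apply Cmod_triangle|]. lra.
Qed.

Lemma vanishing_scal (a : C) (u : nat -> C) :
  vanishing u -> vanishing (fun n => (a * u n)%C).
Proof.
  apply vanishing_le with (M := Cmod a); intros n; rewrite Cmod_mult; apply Rle_refl.
Qed.

Lemma vanishing_opp (u : nat -> C) : vanishing u -> vanishing (fun n => (- u n)%C).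
Proof.
  apply vanishing_le with (M := 1); intros n; rewrite Cmod_opp; lra.
Qed.

Lemma vanishing_finite (u : nat -> C) (N : nat) :
  (forall n, (N <= n)%nat -> u n = RtoC 0) -> vanishing u.
Proof.
  intros H eps He; exists N; intros n Hn; rewrite (H n Hn), Cmod_0; exact He.
Qed.

(** The element of [c_0] with the terms [u], or zero if [u] does not tend to zero. *)
Definition c0_of (u : nat -> C) : c0 :=
  match excluded_middle_informative (vanishing u) with
  | left H => C0 u H
  | right _ => C0 _ vanishing_0
  end.

Lemma term_c0_of (u : nat -> C) (n : nat) : vanishing u -> term (c0_of u) n = u n.
Proof.
  intros H; unfold c0_of.
  destruct (excluded_middle_informative (vanishing u)); [reflexivity|contradiction].
Qed.

Lemma c0_bounded (x : c0) : exists M, forall n, Cmod (term x n) <= M.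
Proof.
  destruct (term_vanishing x 1 Rlt_0_1) as [N HN].
  assert (H : exists M, forall n, (n < N)%nat -> Cmod (term x n) <= M).
  { clear HN; induction N as [|N [M IH]].
    - exists 0; intros n Hn; lia.
    - exists (Rmax M (Cmod (term x N))); intros n Hn.
      destruct (Nat.eq_dec n N) as [E|D]; [rewrite E; apply Rmax_r|].
      eapply Rle_trans; [apply IH; lia|apply Rmax_l]. }
  destruct H as [M HM]; exists (Rmax M 1); intros n.
  destruct (Nat.lt_ge_cases n N) as [L|L].
  - eapply Rle_trans; [apply HM, L|apply Rmax_l].
  - eapply Rle_trans; [apply Rlt_le, HN, L|apply Rmax_r].
Qed.

Lemma c0_range_bound (x : c0) : bound (fun r => exists n, r = Cmod (term x n)).
Proof. destruct (c0_bounded x) as [M HM]; exists M; intros r [n ->]; apply HM. Qed.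

Lemma c0_range_inhabited (x : c0) : exists r, exists n, r = Cmod (term x n).
Proof. exists (Cmod (term x 0)), 0%nat; reflexivity. Qed.

(** The supremum norm. *)
Definition c0_norm (x : c0) : R :=
  proj1_sig (completeness _ (c0_range_bound x) (c0_range_inhabited x)).

Lemma c0_norm_ge (x : c0) (n : nat) : Cmod (term x n) <= c0_norm x.
Proof.
  apply (proj1 (proj2_sig (completeness _ (c0_range_bound x) (c0_range_inhabited x)))).
  exists n; reflexivity.
Qed.

Lemma c0_norm_le (x : c0) (M : R) :
  (forall n, Cmod (term x n) <= M) -> c0_norm x <= M.
Proof.
  intros H.
  apply (proj2 (proj2_sig (completeness _ (c0_range_bound x) (c0_range_inhabited x)))).
  intros r [n ->]; apply H.
Qed.

Definition c0_plus (x y : c0) : c0 :=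
  C0 _ (vanishing_plus _ _ (term_vanishing x) (term_vanishing y)).
Definition c0_zero : c0 := C0 _ vanishing_0.
Definition c0_opp (x : c0) : c0 := C0 _ (vanishing_opp _ (term_vanishing x)).
Definition c0_scal (a : C) (x : c0) : c0 := C0 _ (vanishing_scal a _ (term_vanishing x)).
Definition c0_ball (x : c0) (e : R) (y : c0) : Prop := c0_norm (c0_plus y (c0_opp x)) < e.

Lemma c0_plus_comm x y : c0_plus x y = c0_plus y x.
Proof. apply c0_ext; intros n; simpl; ring. Qed.
Lemma c0_plus_assoc x y z : c0_plus x (c0_plus y z) = c0_plus (c0_plus x y) z.
Proof. apply c0_ext; intros n; simpl; ring. Qed.
Lemma c0_plus_zero x : c0_plus x c0_zero = x.
Proof. apply c0_ext; intros n; simpl; ring. Qed.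
Lemma c0_plus_opp x : c0_plus x (c0_opp x) = c0_zero.
Proof. apply c0_ext; intros n; simpl; ring. Qed.

Definition c0_AbelianMonoid : AbelianMonoid :=
  AbelianMonoid.Pack c0
    (AbelianMonoid.Mixin c0 c0_plus c0_zero c0_plus_comm c0_plus_assoc c0_plus_zero) c0.
Definition c0_AbelianGroup_class : AbelianGroup.class_of c0 :=
  AbelianGroup.Class c0
    (AbelianMonoid.Mixin c0 c0_plus c0_zero c0_plus_comm c0_plus_assoc c0_plus_zero)
    (AbelianGroup.Mixin c0_AbelianMonoid c0_opp c0_plus_opp).
Definition c0_AbelianGroup : AbelianGroup := AbelianGroup.Pack c0 c0_AbelianGroup_class c0.

Lemma c0_scal_assoc (a b : C_AbsRing) (x : c0) :
  c0_scal a (c0_scal b x) = c0_scal (mult a b) x.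
Proof. apply c0_ext; intros n; simpl; apply Cmult_assoc. Qed.
Lemma c0_scal_one (x : c0) : c0_scal (one : C_AbsRing) x = x.
Proof. apply c0_ext; intros n; simpl; apply Cmult_1_l. Qed.
Lemma c0_scal_plus_r (a : C_AbsRing) (x y : c0) :
  c0_scal a (c0_plus x y) = c0_plus (c0_scal a x) (c0_scal a y).
Proof. apply c0_ext; intros n; simpl; apply Cmult_plus_distr_l. Qed.
Lemma c0_scal_plus_l (a b : C_AbsRing) (x : c0) :
  c0_scal (plus a b) x = c0_plus (c0_scal a x) (c0_scal b x).
Proof. apply c0_ext; intros n; simpl; apply Cmult_plus_distr_r. Qed.

Definition c0_ModuleSpace_class : ModuleSpace.class_of C_AbsRing c0 :=
  ModuleSpace.Class C_AbsRing c0 c0_AbelianGroup_class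
    (ModuleSpace.Mixin C_AbsRing c0_AbelianGroup c0_scal
       c0_scal_assoc c0_scal_one c0_scal_plus_r c0_scal_plus_l).

Lemma c0_norm_triangle x y : c0_norm (c0_plus x y) <= c0_norm x + c0_norm y.
Proof.
  apply c0_norm_le; intros n; simpl.
  eapply Rle_trans; [apply Cmod_triangle|].
  apply Rplus_le_compat; apply c0_norm_ge.
Qed.

Lemma c0_norm_scal (a : C) (x : c0) : c0_norm (c0_scal a x) <= Cmod a * c0_norm x.
Proof.
  apply c0_norm_le; intros n; simpl; rewrite Cmod_mult.
  apply Rmult_le_compat_l; [apply Cmod_ge_0|apply c0_norm_ge].
Qed.

Lemma c0_ball_center (x : c0) (e : posreal) : c0_ball x e x.
Proof.
  unfold c0_ball; rewrite c0_plus_opp.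
  eapply Rle_lt_trans; [|apply (cond_pos e)].
  apply c0_norm_le; intros n; simpl; rewrite Cmod_0; apply Rle_refl.
Qed.

Lemma c0_ball_sym (x y : c0) (e : R) : c0_ball x e y -> c0_ball y e x.
Proof.
  unfold c0_ball; intros H; eapply Rle_lt_trans; [|exact H].
  apply c0_norm_le; intros n; simpl.
  replace (term x n + - term y n)%C with (- (term y n + - term x n))%C by ring.
  rewrite Cmod_opp; apply (c0_norm_ge (c0_plus y (c0_opp x)) n).
Qed.

Lemma c0_ball_triangle (x y z : c0) (e1 e2 : R) :
  c0_ball x e1 y -> c0_ball y e2 z -> c0_ball x (e1 + e2) z.
Proof.
  unfold c0_ball; intros H1 H2.
  replace (c0_plus z (c0_opp x))
    with (c0_plus (c0_plus y (c0_opp x)) (c0_plus z (c0_opp y)))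
    by (apply c0_ext; intros n; simpl; ring).
  eapply Rle_lt_trans; [apply c0_norm_triangle|]. lra.
Qed.

Definition c0_UniformSpace_mixin : UniformSpace.mixin_of c0 :=
  UniformSpace.Mixin c0 c0_zero c0_ball c0_ball_center c0_ball_sym c0_ball_triangle.
Definition c0_UniformSpace : UniformSpace := UniformSpace.Pack c0 c0_UniformSpace_mixin c0.

Definition c0_NormedModuleAux : NormedModuleAux C_AbsRing :=
  NormedModuleAux.Pack C_AbsRing c0
    (NormedModuleAux.Class C_AbsRing c0 c0_ModuleSpace_class c0_UniformSpace_mixin) c0.

Lemma c0_norm_compat2 (x y : c0) (e : posreal) :
  c0_ball x e y -> c0_norm (c0_plus y (c0_opp x)) < 1 * e.
Proof. rewrite Rmult_1_l; intros H; exact H. Qed.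

Lemma c0_norm_eq0 (x : c0) : c0_norm x = 0 -> x = c0_zero.
Proof.
  intros H; apply c0_ext; intros n; simpl; apply Cmod_eq_0.
  apply Rle_antisym; [rewrite <- H; apply c0_norm_ge|apply Cmod_ge_0].
Qed.

Definition c0_NormedModule_class : NormedModule.class_of C_AbsRing c0 :=
  NormedModule.Class C_AbsRing c0
    (NormedModuleAux.Class C_AbsRing c0 c0_ModuleSpace_class c0_UniformSpace_mixin)
    (NormedModule.Mixin C_AbsRing c0_NormedModuleAux c0_norm 1
       c0_norm_triangle c0_norm_scal (fun x y eps H => H) c0_norm_compat2 c0_norm_eq0).

(** A Cauchy filter converges uniformly to its termwise limit, which therefore tends
    to zero. *)
Lemma c0_cauchy_converges (F : (c0 -> Prop) -> Prop) :
  ProperFilter F -> cauchy (T := c0_UniformSpace) F ->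
  exists y : c0, forall eps : posreal, F (c0_ball y eps).
Proof.
  intros HF Hc.
  set (G := fun P : (nat -> C) -> Prop => F (fun x => P (term x))).
  assert (HG : ProperFilter G) by (apply (filtermap_proper_filter c0 (nat -> C) term F HF)).
  pose (k := @norm_factor C_AbsRing C_NormedModule).
  assert (Hk : 0 < k) by apply (@norm_factor_gt_0 C_AbsRing C_NormedModule).
  set (u := lim_fct (T := nat) (U := C_CompleteNormedModule) G).
  assert (Hu : forall eps : R, 0 < eps ->
            F (fun x => forall n, Cmod (term x n - u n)%C < eps)).
  { intros eps He.
    assert (He' : 0 < eps / k) by (apply Rdiv_lt_0_compat; assumption).
    pose proof (fun H => complete_cauchy_fct (T := nat) (U := C_CompleteNormedModule) G HG H
      (mkposreal _ He')) as L.
    eapply filter_imp; [|apply L].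
    - intros x Hx n. specialize (Hx n).
      replace eps with (k * (eps / k)) by (field; lra).
      exact (@norm_compat2 C_AbsRing C_NormedModule (u n) (term x n) (mkposreal _ He') Hx).
    - intros e. destruct (Hc e) as [x Hx]. exists (term x).
      unfold G; eapply filter_imp; [|exact Hx].
      intros y Hy n. apply (@norm_compat1 C_AbsRing C_NormedModule).
      eapply Rle_lt_trans; [|exact Hy].
      exact (c0_norm_ge (c0_plus y (c0_opp x)) n). }
  assert (Hv : vanishing u).
  { intros eps He. destruct (@filter_ex _ F HF _ (Hu (eps / 2) ltac:(lra))) as [x Hx].
    destruct (term_vanishing x (eps / 2)) as [N HN]; [lra|].
    exists N; intros n Hn.
    replace (u n) with (term x n + - (term x n - u n))%C by ring.
    eapply Rle_lt_trans; [apply Cmod_triangle|].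
    rewrite Cmod_opp. specialize (HN n Hn); specialize (Hx n); lra. }
  exists (C0 u Hv); intros eps. pose proof (cond_pos eps) as He.
  eapply filter_imp; [|apply (Hu (eps / 2)); lra].
  intros x Hx. unfold c0_ball.
  apply Rle_lt_trans with (eps / 2); [|lra].
  apply c0_norm_le; intros n; apply Rlt_le, Hx.
Qed.

Definition c0_lim (F : (c0 -> Prop) -> Prop) : c0 :=
  epsilon (inhabits c0_zero) (fun y => forall eps : posreal, F (c0_ball y eps)).

Lemma c0_lim_cauchy (F : (c0 -> Prop) -> Prop) :
  ProperFilter F -> cauchy (T := c0_UniformSpace) F ->
  forall eps : posreal, F (c0_ball (c0_lim F) eps).
Proof.
  intros HF Hc; unfold c0_lim.
  exact (epsilon_spec _ _ (c0_cauchy_converges F HF Hc)).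
Qed.

Lemma c0_lim_close (F1 F2 : (c0 -> Prop) -> Prop) :
  filter_le F1 F2 -> filter_le F2 F1 ->
  close (M := c0_UniformSpace) (c0_lim F1) (c0_lim F2).
Proof.
  intros H1 H2.
  assert (E : F1 = F2).
  { apply functional_extensionality; intros P; apply propositional_extensionality.
    split; [apply H2|apply H1]. }
  rewrite E; intros eps; apply ball_center.
Qed.

(** The space [c_0] as a complex Banach space. *)
Definition c0_space : CompleteNormedModule C_AbsRing :=
  CompleteNormedModule.Pack C_AbsRing c0
    (CompleteNormedModule.Class C_AbsRing c0 c0_NormedModule_class
       (CompleteSpace.Mixin c0_UniformSpace c0_lim c0_lim_cauchy c0_lim_close)) c0.

(** * Multiplication operators *)

Lemma term_plus (x y : c0_space) n : term (plus x y) n = (term x n + term y n)%C.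
Proof. reflexivity. Qed.
Lemma term_opp (x : c0_space) n : term (opp x) n = (- term x n)%C.
Proof. reflexivity. Qed.
Lemma term_minus (x y : c0_space) n : term (minus x y) n = (term x n - term y n)%C.
Proof. reflexivity. Qed.
Lemma term_scal (a : C) (x : c0_space) n :
  term (scal (a : C_AbsRing) x) n = (a * term x n)%C.
Proof. reflexivity. Qed.
Lemma term_zero n : term (zero : c0_space) n = RtoC 0.
Proof. reflexivity. Qed.

Lemma norm_ge_term (x : c0_space) n : Cmod (term x n) <= norm x.
Proof. exact (c0_norm_ge x n). Qed.
Lemma norm_le_terms (x : c0_space) M : (forall n, Cmod (term x n) <= M) -> norm x <= M.
Proof. exact (c0_norm_le x M). Qed.

Lemma ball_terms (x y : c0_space) (e : R) :
  ball x e y <-> norm (minus y x) < e.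
Proof. reflexivity. Qed.

Definition bounded_seq (d : nat -> C) : Prop := exists M, forall n, Cmod (d n) <= M.

(** Termwise multiplication by the sequence [d]; it is meaningful on all of [c_0]
    when [d] is bounded. *)
Definition mulop (d : nat -> C) (x : c0_space) : c0_space :=
  c0_of (fun n => (d n * term x n)%C).

Lemma term_mulop d x n : bounded_seq d -> term (mulop d x) n = (d n * term x n)%C.
Proof.
  intros [M HM]; unfold mulop; apply term_c0_of.
  apply (vanishing_le (term x) _ M); [|apply term_vanishing].
  intros k; rewrite Cmod_mult.
  apply Rmult_le_compat_r; [apply Cmod_ge_0|apply HM].
Qed.

Lemma norm_mulop d M x :
  (forall n, Cmod (d n) <= M) -> norm (mulop d x) <= M * norm x.
Proof.
  intros H; apply norm_le_terms; intros n.
  rewrite term_mulop, Cmod_mult by (exists M; exact H).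
  apply Rmult_le_compat; auto using Cmod_ge_0, norm_ge_term.
Qed.

Lemma mulop_linear d : bounded_seq d -> is_linear (mulop d).
Proof.
  intros Hd; split.
  - intros x y; apply c0_ext; intros n.
    rewrite term_plus, !term_mulop, term_plus by exact Hd; ring.
  - intros k x; apply c0_ext; intros n.
    rewrite term_scal, !term_mulop, term_scal by exact Hd; ring.
  - destruct Hd as [M HM]. exists (Rmax M 1); split.
    + pose proof (Rmax_r M 1); lra.
    + intros x. apply norm_mulop. intros n.
      eapply Rle_trans; [apply HM|apply Rmax_l].
Qed.

Lemma mulop_iter d k x n : bounded_seq d ->
  term (Nat.iter k (mulop d) x) n = (Cpow (d n) k * term x n)%C.
Proof.
  intros Hd; induction k as [|k IH].
  - simpl; ring.
  - change (term (mulop d (Nat.iter k (mulop d) x)) n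
      = (d n * Cpow (d n) k * term x n)%C).
    rewrite term_mulop, IH by exact Hd; ring.
Qed.

(** The first [N] terms of [x], followed by zeros. *)
Definition trunc (N : nat) (x : c0_space) : c0_space :=
  c0_of (fun n => if (n <? N)%nat then term x n else RtoC 0).

Lemma term_trunc N x n :
  term (trunc N x) n = if (n <? N)%nat then term x n else RtoC 0.
Proof.
  unfold trunc; apply term_c0_of.
  apply (vanishing_finite _ N); intros k Hk.
  destruct (Nat.ltb_spec k N); [lia|reflexivity].
Qed.

Lemma trunc_close (x : c0_space) (eps : R) : 0 < eps -> exists N0, forall N, (N0 <= N)%nat ->
  ball x eps (trunc N x).
Proof.
  intros He. destruct (term_vanishing x (eps / 2)) as [N0 HN]; [lra|].
  exists N0; intros N HNN. apply ball_terms.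
  apply Rle_lt_trans with (eps / 2); [|lra].
  apply norm_le_terms; intros n; rewrite term_minus, term_trunc.
  destruct (Nat.ltb_spec n N).
  - replace (term x n - term x n)%C with (RtoC 0) by ring. rewrite Cmod_0; lra.
  - replace (RtoC 0 - term x n)%C with (- term x n)%C by ring.
    rewrite Cmod_opp; apply Rlt_le, HN; lia.
Qed.

(** * Diagonal operators and their sectoriality *)

(** The graph of the multiplication by [lam], with its maximal domain. *)
Definition diag (lam : nat -> R) : c0_space -> c0_space -> Prop :=
  fun x y => forall n, term y n = (RtoC (lam n) * term x n)%C.

Definition diverging (lam : nat -> R) : Prop :=
  forall M, exists N, forall n, (N <= n)%nat -> M <= lam n.

Lemma diag_is_operator lam : is_operator c0_space (diag lam).
Proof.
  unfold diag; repeat split.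
  - intros n; rewrite term_zero; ring.
  - intros x x' y y' H H' n; rewrite !term_plus, H, H'; ring.
  - intros c x y H n; rewrite !term_scal, H; ring.
  - intros x y y' H H'; apply c0_ext; intros n; rewrite H, H'; reflexivity.
Qed.

Lemma ball_term_lt (x y : c0_space) (e : R) n : ball x e y -> Cmod (term y n - term x n)%C < e.
Proof.
  intros H; apply ball_terms in H. eapply Rle_lt_trans; [|exact H].
  rewrite <- term_minus; apply norm_ge_term.
Qed.

(** If the equation fails at one index, it fails there for all nearby pairs. *)
Lemma diag_closed lam : closed_op c0_space (diag lam).
Proof.
  intros [x y] H n; simpl.
  apply NNPP; intros E.
  apply Cminus_eq_contra, Cmod_gt_0 in E.
  set (d := Cmod (term y n - RtoC (lam n) * term x n)%C) in *.
  set (L := Rabs (lam n)).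
  assert (HL : 0 <= L) by apply Rabs_pos.
  assert (He : 0 < d / (1 + L)) by (apply Rdiv_lt_0_compat; lra).
  apply H. exists (mkposreal _ He). intros [x' y'] [Hx Hy] D; simpl in *.
  specialize (D n).
  apply (ball_term_lt x x' _ n) in Hx. apply (ball_term_lt y y' _ n) in Hy.
  assert (F : d < d).
  { unfold d at 1.
    replace (term y n - RtoC (lam n) * term x n)%C
      with (- (term y' n - term y n) + RtoC (lam n) * (term x' n - term x n))%C
      by (rewrite D; ring).
    eapply Rle_lt_trans; [apply Cmod_triangle|].
    rewrite Cmod_opp, Cmod_mult, Cmod_R. fold L.
    apply Rlt_le_trans with (d / (1 + L) + L * (d / (1 + L))); [|right; field; lra].
    apply Rplus_lt_le_compat; [exact Hy|].
    apply Rmult_le_compat_l; [exact HL|apply Rlt_le; exact Hx]. }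
  lra.
Qed.

Lemma diag_trunc lam N x :
  diag lam (trunc N x) (c0_of (fun n => RtoC (lam n) * term (trunc N x) n)%C).
Proof.
  intros n; apply term_c0_of. apply (vanishing_finite _ N); intros k Hk.
  rewrite term_trunc. destruct (Nat.ltb_spec k N); [lia|ring].
Qed.

Lemma diag_densely_defined lam : densely_defined c0_space (diag lam).
Proof.
  intros x eps. destruct (trunc_close x eps (cond_pos eps)) as [N HN].
  exists (trunc N x); split; [apply HN; apply le_n|].
  eexists; apply diag_trunc.
Qed.

Lemma bounded_from (d : nat -> C) (B : R) N :
  (forall n, (N <= n)%nat -> Cmod (d n) <= B) -> bounded_seq d.
Proof.
  revert B; induction N as [|N IH]; intros B H.
  - exists B; intros n; apply H; lia.
  - apply (IH (Rmax B (Cmod (d N)))); intros n Hn.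
    destruct (Nat.eq_dec n N) as [E|E].
    + rewrite E; apply Rmax_r.
    + eapply Rle_trans; [apply H; lia|apply Rmax_l].
Qed.

Lemma bounded_inverse_shift lam z : diverging lam ->
  (forall n, (z + RtoC (lam n))%C <> RtoC 0) ->
  bounded_seq (fun n => (/ (z + RtoC (lam n)))%C).
Proof.
  intros Hlam Hz. destruct (Hlam (Cmod z + 1)) as [N HN].
  apply (bounded_from _ 1 N); intros n Hn. specialize (HN n Hn).
  rewrite Cmod_inv by apply Hz.
  assert (H : 1 <= Cmod (z + RtoC (lam n))%C).
  { pose proof (Cmod_triangle (z + RtoC (lam n))%C (- z)%C) as T.
    replace (z + RtoC (lam n) + - z)%C with (RtoC (lam n)) in T by ring.
    rewrite Cmod_opp, Cmod_R in T. pose proof (Rle_abs (lam n)). lra. }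
  rewrite <- Rinv_1. apply Rinv_le_contravar; lra.
Qed.

Lemma diag_shift_inverse lam z : diverging lam ->
  (forall n, (z + RtoC (lam n))%C <> RtoC 0) ->
  is_shift_inverse c0_space (diag lam) z (mulop (fun n => (/ (z + RtoC (lam n)))%C)).
Proof.
  intros Hlam Hz. pose proof (bounded_inverse_shift lam z Hlam Hz) as Hb.
  split; [apply mulop_linear; exact Hb|].
  intros x y; split.
  - intros <- n. rewrite term_minus, term_scal, term_mulop by exact Hb.
    field; apply Hz.
  - intros H; apply c0_ext; intros n. rewrite term_mulop by exact Hb.
    specialize (H n); rewrite term_minus, term_scal in H.
    replace (term y n) with ((term y n - z * term x n) + z * term x n)%C by ring.
    rewrite H. field; apply Hz.
Qed.

Lemma shift_inverse_term lam z S y n : is_shift_inverse c0_space (diag lam) z S ->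
  ((z + RtoC (lam n)) * term (S y) n)%C = term y n.
Proof.
  intros [_ H]. pose proof (proj1 (H (S y) y) eq_refl n) as E.
  rewrite term_minus, term_scal in E.
  replace (term y n) with ((term y n - z * term (S y) n) + z * term (S y) n)%C by ring.
  rewrite E; ring.
Qed.

(** A point [z] of the sector of half-angle [PI - vartheta] has distance at least
    [|z| sin vartheta] from the negative half-line. *)
Lemma sector_distance (vartheta lam : R) (z : C) : 0 < vartheta < PI -> 0 <= lam ->
  sector (PI - vartheta) z ->
  Cmod z * sin vartheta <= Cmod (z + RtoC lam)%C.
Proof.
  intros Hv Hl (rho & phi & Hrho & Hphi & ->).
  assert (Hc : - cos vartheta <= cos phi).
  { rewrite <- Rtrigo_facts.cos_pi_minus.
    replace (cos phi) with (cos (Rabs phi)).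
    - apply Rlt_le, cos_decreasing_1; try lra. apply Rabs_pos.
    - unfold Rabs; destruct (Rcase_abs phi); [apply cos_neg|reflexivity]. }
  pose proof (sin2_cos2 phi) as Hp. pose proof (sin2_cos2 vartheta) as Hw.
  assert (Hs : 0 < sin vartheta) by (apply sin_gt_0; lra).
  unfold Rsqr in Hp, Hw.
  assert (E : Cmod (polar rho phi) = rho).
  { unfold Cmod, polar; simpl.
    replace (rho * cos phi * (rho * cos phi * 1) + rho * sin phi * (rho * sin phi * 1))
      with (rho * rho * (sin phi * sin phi + cos phi * cos phi)) by ring.
    rewrite Hp, Rmult_1_r. apply sqrt_square; lra. }
  rewrite E. unfold Cmod, polar; simpl.
  rewrite <- (sqrt_square (rho * sin vartheta)) by nra.
  apply sqrt_le_1_alt.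
  set (c := cos phi) in *; set (s := sin phi) in *; set (S := sin vartheta) in *;
  set (D := cos vartheta) in *.
  (* |z + lam|^2 - (rho S)^2 = 2 rho lam (c + D) + (lam - rho D)^2 *)
  assert (H1 : rho * lam * (c + D) >= 0) by (apply Rle_ge; repeat apply Rmult_le_pos; lra).
  assert (H2 : 0 <= (lam - rho * D) * (lam - rho * D)) by apply Rle_0_sqr.
  replace (rho * S * (rho * S)) with (rho * rho * (1 - D * D)) by (rewrite <- Hw; ring).
  replace ((rho * c + lam) * ((rho * c + lam) * 1) + (rho * s + 0) * ((rho * s + 0) * 1))
    with (rho * rho * (s * s + c * c) + 2 * (rho * lam * (c + D)) - 2 * (rho * lam * D)
          + lam * lam) by ring.
  rewrite Hp. lra.
Qed.

(** A value [z] outside the sequence [lam] is at positive distance from it because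
    [lam] diverges, hence lies in the resolvent set. *)
Lemma diag_Sect theta lam : 0 <= theta ->
  (forall n, 0 < lam n) -> diverging lam -> Sect theta (diag lam).
Proof.
  intros Ht Hpos Hlam.
  split; [apply diag_is_operator|]. split; [apply diag_closed|].
  split; [apply diag_densely_defined|]. split.
  - intros z Hz.
    assert (H : exists n, z = RtoC (lam n)).
    { apply NNPP; intros H; apply Hz. eexists. apply diag_shift_inverse; [exact Hlam|].
      intros n E; apply H; exists n.
      replace z with (RtoC (lam n) - (- z + RtoC (lam n)))%C by ring. rewrite E; ring. }
    destruct H as [n ->]. exists (lam n), 0. split; [apply Rlt_le, Hpos|].
    split; [rewrite Rabs_R0; exact Ht|].
    unfold polar, RtoC; rewrite cos_0, sin_0; f_equal; ring.
  - intros vartheta Hv. exists (/ sin vartheta).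
    intros z S Hz HS x.
    assert (Hs : 0 < sin vartheta) by (apply sin_gt_0; lra).
    apply norm_le_terms; intros n. rewrite term_scal, Cmod_mult.
    pose proof (sector_distance vartheta (lam n) z ltac:(lra)
      (Rlt_le _ _ (Hpos n)) Hz) as D.
    pose proof (f_equal Cmod (shift_inverse_term lam z S x n HS)) as E.
    rewrite Cmod_mult in E. pose proof (norm_ge_term x n) as B.
    pose proof (Cmod_ge_0 (term (S x) n)).
    apply Rmult_le_reg_l with (sin vartheta); [exact Hs|].
    replace (sin vartheta * (/ sin vartheta * norm x)) with (norm x) by (field; lra).
    rewrite <- E in B. nra.
Qed.

(** * The semigroup of a diagonal operator *)

Lemma at_right_0_iff (P : R -> Prop) :
  at_right 0 P <-> exists d, 0 < d /\ forall t, 0 < t < d -> P t.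
Proof.
  split.
  - intros [d Hd]; exists d; split; [apply cond_pos|]; intros t Ht.
    apply Hd; [|lra]. unfold ball; simpl; unfold AbsRing_ball, abs, minus, plus, opp; simpl.
    rewrite Rabs_pos_eq; lra.
  - intros (d & Hd & H); exists (mkposreal d Hd); intros t Ht Ht0; apply H.
    unfold ball in Ht; simpl in Ht; unfold AbsRing_ball, abs, minus, plus, opp in Ht;
    simpl in Ht. rewrite Rabs_pos_eq in Ht; lra.
Qed.

Lemma exp_le_1 u : 0 <= u -> exp (- u) <= 1.
Proof.
  intros [H| <-].
  - rewrite <- exp_0; apply Rlt_le, exp_increasing; lra.
  - rewrite Ropp_0, exp_0; lra.
Qed.

Lemma exp_first_difference u : 0 <= u -> 0 <= 1 - exp (- u) <= Rmin 1 u.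
Proof.
  intros H. pose proof (exp_le_1 u H). pose proof (exp_pos (- u)).
  pose proof (exp_ineq1_le (- u)). split; [lra|]. apply Rmin_glb; lra.
Qed.

(** The upper bound by [u] comes from [exp (- u) <= 1 / (1 + u) <= 1 - u + u^2]. *)
Lemma exp_difference_quotient u : 0 < u -> 0 <= (exp (- u) - 1) / u + 1 <= Rmin 1 u.
Proof.
  intros H. pose proof (exp_le_1 u ltac:(lra)) as H1.
  pose proof (exp_ineq1_le (- u)) as H2. pose proof (exp_ineq1_le u) as H3.
  assert (H4 : exp (- u) * exp u = 1) by (rewrite <- exp_plus, Rplus_opp_l; apply exp_0).
  pose proof (exp_pos (- u)).
  assert (H5 : exp (- u) * (1 + u) <= 1) by nra.
  assert (H6 : (exp (- u) - (1 - u + u * u)) * (1 + u) <= 0).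
  { replace ((exp (- u) - (1 - u + u * u)) * (1 + u))
      with (exp (- u) * (1 + u) - 1 - u * u * u) by ring.
    assert (0 <= u * u * u) by (repeat apply Rmult_le_pos; lra). lra. }
  assert (H7 : exp (- u) <= 1 - u + u * u) by nra.
  replace ((exp (- u) - 1) / u + 1) with ((exp (- u) - 1 + u) / u) by (field; lra).
  split; [apply Rle_mult_inv_pos; lra|].
  apply Rmin_glb; apply Rle_div_l; lra.
Qed.

(** Multipliers bounded by 1 that vanish at each index as [t] decreases to 0 vanish
    uniformly after multiplication by a fixed element of [c_0]. *)
Lemma c0_dominated_convergence (d : R -> nat -> R) (b : nat -> R) (z : c0_space) (eps : R) :
  (forall t n, 0 < t -> 0 <= d t n <= Rmin 1 (t * b n)) -> 0 < eps ->
  exists del, 0 < del /\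
    forall t, 0 < t < del -> forall n, d t n * Cmod (term z n) <= eps.
Proof.
  intros Hd He. destruct (term_vanishing z eps He) as [N HN].
  assert (H : exists del, 0 < del /\ forall t, 0 < t < del -> forall n, (n < N)%nat ->
    d t n * Cmod (term z n) <= eps).
  { clear HN; induction N as [|N (del & Hdel & IH)].
    - exists 1; split; [lra|]; intros; lia.
    - set (B := Rabs (b N) * Cmod (term z N) + 1).
      assert (HB : 0 < B).
      { unfold B; pose proof (Rabs_pos (b N)); pose proof (Cmod_ge_0 (term z N)); nra. }
      exists (Rmin del (eps / B)); split.
      + apply Rmin_glb_lt; [exact Hdel|apply Rdiv_lt_0_compat; assumption].
      + intros t [Ht0 Ht] n Hn.
        apply Rmin_Rgt in Ht as [Ht1 Ht2].
        destruct (Nat.eq_dec n N) as [E|E]; [|apply IH; [lra|lia]].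
        rewrite E. destruct (Hd t N Ht0) as [_ H2].
        pose proof (Rmin_r 1 (t * b N)). pose proof (Rle_abs (b N)).
        pose proof (Cmod_ge_0 (term z N)).
        apply (Rmult_gt_compat_r B) in Ht2; [|exact HB].
        replace (eps / B * B) with eps in Ht2 by (field; lra).
        apply Rle_trans with (t * Rabs (b N) * Cmod (term z N)).
        * apply Rmult_le_compat_r; [assumption|]. nra.
        * unfold B in Ht2. nra. }
  destruct H as (del & Hdel & H); exists del; split; [exact Hdel|].
  intros t Ht n. destruct (Nat.lt_ge_cases n N) as [L|L]; [apply H; assumption|].
  specialize (HN n L). destruct (Hd t n) as [H1 H2]; [lra|].
  pose proof (Rmin_l 1 (t * b n)). pose proof (Cmod_ge_0 (term z n)). nra.
Qed.

(** The operator [e^{-tA}] for the diagonal operator [A] with entries [lam]. *)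
Definition diag_exp (lam : nat -> R) (t : R) : c0_space -> c0_space :=
  mulop (fun n => RtoC (exp (- (t * lam n)))).

Section Semigroup.
Context (lam : nat -> R) (Hpos : forall n, 0 < lam n).

Lemma diag_exp_bounded t : 0 <= t -> bounded_seq (fun n => RtoC (exp (- (t * lam n)))).
Proof.
  intros Ht; exists 1; intros n. rewrite Cmod_R, Rabs_pos_eq by apply Rlt_le, exp_pos.
  apply exp_le_1. specialize (Hpos n); nra.
Qed.

Lemma term_diag_exp t x n : 0 <= t ->
  term (diag_exp lam t x) n = (RtoC (exp (- (t * lam n))) * term x n)%C.
Proof. intros Ht; apply term_mulop, diag_exp_bounded, Ht. Qed.

Lemma diag_exp_C0_semigroup : C0_semigroup c0_space (diag_exp lam).
Proof.
  split; [|split; [|split]].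
  - intros t Ht; apply mulop_linear, diag_exp_bounded, Ht.
  - intros x; apply c0_ext; intros n. rewrite term_diag_exp by lra.
    rewrite Rmult_0_l, Ropp_0, exp_0; ring.
  - intros t u x Ht Hu; apply c0_ext; intros n. rewrite !term_diag_exp by lra.
    rewrite Rmult_plus_distr_r, Ropp_plus_distr, exp_plus, RtoC_mult; ring.
  - intros x. apply filterlim_locally; intros eps. apply at_right_0_iff.
    destruct (c0_dominated_convergence (fun t n => 1 - exp (- (t * lam n))) lam x (eps / 2))
      as (del & Hdel & H).
    + intros t n Ht; apply exp_first_difference. specialize (Hpos n); nra.
    + pose proof (cond_pos eps); lra.
    + exists del; split; [exact Hdel|]. intros t Ht. apply ball_terms.
      apply Rle_lt_trans with (eps / 2); [|pose proof (cond_pos eps); lra].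
      apply norm_le_terms; intros n. rewrite term_minus, term_diag_exp by lra.
      eapply Rle_trans; [|apply (H t Ht n)].
      replace (RtoC (exp (- (t * lam n))) * term x n - term x n)%C
        with (- (RtoC (1 - exp (- (t * lam n))) * term x n))%C
        by (rewrite RtoC_minus; ring).
      rewrite Cmod_opp, Cmod_mult, Cmod_R, Rabs_pos_eq; [apply Rle_refl|].
      apply exp_first_difference. specialize (Hpos n); nra.
Qed.

Lemma diag_exp_generator x y : generator c0_space (diag_exp lam) x y <-> diag lam x (opp y).
Proof.
  assert (Q : forall t n, 0 < t ->
    term (scal (RtoC (/ t) : C_AbsRing) (minus (diag_exp lam t x) x)) n
    = (RtoC ((exp (- (t * lam n)) - 1) / (t * lam n) + 1) * (RtoC (lam n) * term x n)
       - RtoC (lam n) * term x n)%C).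
  { intros t n Ht. rewrite term_scal, term_minus, term_diag_exp by lra.
    replace ((exp (- (t * lam n)) - 1) / (t * lam n) + 1)
      with (/ t * (exp (- (t * lam n)) - 1) * / lam n + 1)
      by (field; specialize (Hpos n); lra).
    rewrite RtoC_plus, !RtoC_mult, RtoC_minus, (RtoC_inv (lam n))
      by (specialize (Hpos n); lra).
    field. intros E. apply RtoC_inj in E. specialize (Hpos n); lra. }
  assert (D : forall t n, 0 < t ->
    0 <= (exp (- (t * lam n)) - 1) / (t * lam n) + 1 <= Rmin 1 (t * lam n)).
  { intros t n Ht; apply exp_difference_quotient. specialize (Hpos n); nra. }
  split.
  - intros H n. unfold generator in H.
    apply NNPP; intros E. apply Cminus_eq_contra, Cmod_gt_0 in E.
    rewrite term_opp in E.
    set (e := Cmod (- term y n - RtoC (lam n) * term x n)%C) in *.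
    set (w := Cmod (RtoC (lam n) * term x n)%C).
    assert (Hw : 0 <= w) by apply Cmod_ge_0.
    assert (He2 : 0 < e / 2) by lra.
    pose proof (proj1 (filterlim_locally _ _) H (mkposreal _ He2)) as H'.
    apply at_right_0_iff in H' as (del & Hdel & H').
    (* [t] is chosen with [t * lam n * w < e / 2], where [t * lam n] bounds the
       multiplier of [lam n * term x n]. *)
    set (t := Rmin (del / 2) (e / 2 / (lam n * w + 1))).
    specialize (Hpos n).
    assert (Hden : 0 < lam n * w + 1) by nra.
    assert (Ht : 0 < t) by (apply Rmin_glb_lt; [lra|apply Rdiv_lt_0_compat; lra]).
    assert (Ht1 : t < del) by (apply Rle_lt_trans with (del / 2); [apply Rmin_l|lra]).
    assert (Ht2 : t * (lam n * w + 1) <= e / 2).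
    { apply Rle_div_r; [exact Hden|]. apply Rmin_r. }
    specialize (H' t (conj Ht Ht1)). apply (ball_term_lt _ _ _ n) in H'.
    rewrite Q in H' by exact Ht. simpl in H'.
    specialize (D t n Ht).
    set (a := (exp (- (t * lam n)) - 1) / (t * lam n) + 1) in *.
    assert (F : e < e).
    { unfold e at 1.
      replace (- term y n - RtoC (lam n) * term x n)%C
        with ((RtoC a * (RtoC (lam n) * term x n) - RtoC (lam n) * term x n - term y n)
              + - (RtoC a * (RtoC (lam n) * term x n)))%C by ring.
      eapply Rle_lt_trans; [apply Cmod_triangle|].
      rewrite Cmod_opp, (Cmod_mult (RtoC a)), Cmod_R, Rabs_pos_eq by lra. fold w.
      pose proof (Rmin_r 1 (t * lam n)).
      assert (a * w <= t * lam n * w) by (apply Rmult_le_compat_r; lra).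
      lra. }
    lra.
  - intros H. apply filterlim_locally; intros eps. apply at_right_0_iff.
    destruct (c0_dominated_convergence
      (fun t n => (exp (- (t * lam n)) - 1) / (t * lam n) + 1) lam (opp y) (eps / 2) D)
      as (del & Hdel & H').
    { pose proof (cond_pos eps); lra. }
    exists del; split; [exact Hdel|]. intros t Ht. apply ball_terms.
    apply Rle_lt_trans with (eps / 2); [|pose proof (cond_pos eps); lra].
    apply norm_le_terms; intros n. rewrite term_minus, Q by lra.
    eapply Rle_trans; [|apply (H' t Ht n)].
    rewrite <- H, term_opp.
    set (a := (exp (- (t * lam n)) - 1) / (t * lam n) + 1).
    replace (RtoC a * - term y n - - term y n - term y n)%C
      with (RtoC a * - term y n)%C by ring.
    rewrite Cmod_mult, Cmod_R, Rabs_pos_eq; [apply Rle_refl|].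
    apply D; lra.
Qed.

Lemma diag_is_exp_semigroup : is_exp_semigroup (diag lam) (diag_exp lam).
Proof. split; [apply diag_exp_C0_semigroup|apply diag_exp_generator]. Qed.
End Semigroup.

(** * The beta integral *)

(** Monotone convergence along a filter. *)
Lemma increasing_along_filter {T : Type} (F : (T -> Prop) -> Prop) (FF : Filter F)
  (D : T -> Prop) (G : T -> R) (M : R) :
  (exists a, D a) -> (forall a, D a -> G a <= M) ->
  (forall a, D a -> F (fun b => D b /\ G a <= G b)) ->
  exists L, filterlim G F (locally L).
Proof.
  intros [a0 Ha0] HM HF.
  destruct (completeness (fun r => exists a, D a /\ r = G a)) as [L [HL1 HL2]].
  - exists M; intros r [a [Ha ->]]; auto.
  - exists (G a0), a0; auto.
  - exists L. apply filterlim_locally; intros eps.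
    assert (H : exists a, D a /\ L - eps < G a).
    { apply NNPP; intros N. assert (L <= L - eps); [|pose proof (cond_pos eps); lra].
      apply HL2; intros r [a [Ha ->]]. apply Rnot_lt_le; intros Hlt.
      apply N; exists a; auto. }
    destruct H as [a [Ha Hlt]].
    eapply filter_imp; [|apply (HF a Ha)]. intros b [Hb Hab].
    assert (G b <= L) by (apply HL1; exists b; auto).
    unfold ball; simpl; unfold AbsRing_ball, abs, minus, plus, opp; simpl.
    apply Rabs_def1; pose proof (cond_pos eps); lra.
Qed.

Lemma is_derive_Rpower (p t : R) : 0 < t ->
  is_derive (fun t => Rpower t p) t (p * Rpower t (p - 1)).
Proof.
  intros Ht. unfold Rpower. auto_derive; [exact Ht|].
  replace ((p - 1) * ln t) with (p * ln t + - ln t) by ring.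
  rewrite exp_plus, exp_Ropp, exp_ln by exact Ht. field; lra.
Qed.

Lemma continuous_Rpower (p t : R) : 0 < t -> continuous (fun t => Rpower t p) t.
Proof.
  intros Ht; apply (ex_derive_continuous (K := R_AbsRing) (V := R_NormedModule)).
  eexists; apply is_derive_Rpower, Ht.
Qed.

Lemma is_RInt_Rpower (p a b : R) : p <> 0 -> 0 < a -> a <= b ->
  is_RInt (fun t => Rpower t (p - 1)) a b ((Rpower b p - Rpower a p) / p).
Proof.
  intros Hp Ha Hab.
  replace ((Rpower b p - Rpower a p) / p)
    with (minus (/ p * Rpower b p) (/ p * Rpower a p))
    by (unfold minus, plus, opp; simpl; field; exact Hp).
  apply (is_RInt_derive (fun t => / p * Rpower t p)).
  - intros t Ht; rewrite Rmin_left, Rmax_right in Ht by exact Hab.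
    evar_last; [apply is_derive_scal, is_derive_Rpower; lra|].
    simpl. field; exact Hp.
  - intros t Ht; rewrite Rmin_left, Rmax_right in Ht by exact Hab.
    apply continuous_Rpower; lra.
Qed.

(** The integrand of [beta s (k - s)], for an integer [k]. *)
Definition beta_integrand (s : R) (k : nat) (t : R) : R := Rpower t (s - 1) / (1 + t) ^ k.

Lemma beta_integrand_continuous s k t : 0 < t -> continuous (beta_integrand s k) t.
Proof.
  intros Ht; apply (ex_derive_continuous (K := R_AbsRing) (V := R_NormedModule)).
  unfold beta_integrand, Rpower; auto_derive; split; [exact Ht|].
  split; [apply pow_nonzero; lra|exact I].
Qed.

Lemma ex_RInt_beta s k a b : 0 < a -> 0 < b -> ex_RInt (beta_integrand s k) a b.
Proof.
  intros Ha Hb; apply (ex_RInt_continuous (V := R_CompleteNormedModule)).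
  intros t Ht; apply beta_integrand_continuous.
  pose proof (Rmin_glb_lt _ _ _ Ha Hb); lra.
Qed.

Lemma beta_integrand_pos s k t : 0 < t -> 0 < beta_integrand s k t.
Proof.
  intros Ht; apply Rdiv_lt_0_compat; [apply exp_pos|apply pow_lt; lra].
Qed.

(** The integrand is at most [t^(s-1)] on (0, 1] and at most [t^(s-k-1)] on
    [1, oo). *)
Lemma RInt_beta_bound s k a b : 0 < s -> s < INR k -> 0 < a <= 1 -> 1 <= b ->
  RInt (beta_integrand s k) a b <= / s + / (INR k - s).
Proof.
  intros Hs Hk Ha Hb.
  rewrite <- (RInt_Chasles (V := R_CompleteNormedModule) _ a 1 b)
    by (apply ex_RInt_beta; lra).
  apply Rplus_le_compat.
  - pose proof (is_RInt_Rpower s a 1 ltac:(lra) ltac:(lra) ltac:(lra)) as H.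
    apply Rle_trans with (RInt (fun t => Rpower t (s - 1)) a 1).
    + apply RInt_le; [lra|apply ex_RInt_beta; lra|eexists; exact H|].
      intros t Ht; unfold beta_integrand. apply Rle_div_l; [apply pow_lt; lra|].
      assert (1 <= (1 + t) ^ k) by (apply pow_R1_Rle; lra).
      pose proof (exp_pos ((s - 1) * ln t)). unfold Rpower. nra.
    + rewrite (is_RInt_unique _ _ _ _ H). unfold Rpower at 1; rewrite ln_1, Rmult_0_r, exp_0.
      pose proof (exp_pos (s * ln a)). unfold Rpower, Rdiv.
      rewrite <- (Rmult_1_l (/ s)) at 2.
      apply Rmult_le_compat_r; [apply Rlt_le, Rinv_0_lt_compat; lra|lra].
  - pose proof (is_RInt_Rpower (s - INR k) 1 b ltac:(lra) ltac:(lra) ltac:(lra)) as H.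
    apply Rle_trans with (RInt (fun t => Rpower t (s - INR k - 1)) 1 b).
    + apply RInt_le; [lra|apply ex_RInt_beta; lra|eexists; exact H|].
      intros t Ht; unfold beta_integrand.
      replace (s - INR k - 1) with ((s - 1) + - INR k) by ring.
      rewrite Rpower_plus, Rpower_Ropp, Rpower_pow by lra.
      apply Rmult_le_compat_l; [apply Rlt_le, exp_pos|].
      apply Rinv_le_contravar; [apply pow_lt; lra|apply pow_incr; lra].
    + rewrite (is_RInt_unique _ _ _ _ H).
      unfold Rpower at 2; rewrite ln_1, Rmult_0_r, exp_0.
      pose proof (exp_pos ((s - INR k) * ln b)). unfold Rpower.
      set (E := exp _) in *.
      replace ((E - 1) / (s - INR k)) with ((1 - E) * / (INR k - s)) by (field; lra).
      rewrite <- (Rmult_1_l (/ (INR k - s))) at 2.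
      apply Rmult_le_compat_r; [apply Rlt_le, Rinv_0_lt_compat; lra|lra].
Qed.

Lemma filter_prod_0_infty (P : R * R -> Prop) (a0 b0 : R) : 0 < a0 ->
  (forall a b, 0 < a < a0 -> b0 < b -> P (a, b)) ->
  filter_prod (at_right 0) (Rbar_locally p_infty) P.
Proof.
  intros Ha H. apply (Filter_prod _ _ _ (fun a => 0 < a < a0) (fun b => b0 < b)).
  - apply at_right_0_iff; exists a0; auto.
  - exists b0; auto.
  - exact H.
Qed.

Lemma beta_integral_exists s k : 0 < s -> s < INR k ->
  exists l, is_RInt_gen (beta_integrand s k) (at_right 0) (Rbar_locally p_infty) l.
Proof.
  intros Hs Hk.
  destruct (increasing_along_filter (filter_prod (at_right 0) (Rbar_locally p_infty)) _
    (fun ab => 0 < fst ab <= 1 /\ 1 <= snd ab)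
    (fun ab => RInt (beta_integrand s k) (fst ab) (snd ab)) (/ s + / (INR k - s)))
    as [L HL].
  - exists (1, 1); simpl; lra.
  - intros [a b] [Ha Hb]; apply RInt_beta_bound; assumption.
  - intros [a b] [Ha Hb]; simpl in Ha, Hb.
    apply (filter_prod_0_infty _ a b); [lra|]; simpl; intros a' b' Ha' Hb'.
    split; [lra|].
    rewrite <- (RInt_Chasles (V := R_CompleteNormedModule) _ a' a b'),
      <- (RInt_Chasles (V := R_CompleteNormedModule) _ a b b')
      by (apply ex_RInt_beta; lra).
    assert (Q : forall c e, 0 < c -> c <= e -> 0 <= RInt (beta_integrand s k) c e).
    { intros c e Hc Hce; apply RInt_ge_0; [exact Hce|apply ex_RInt_beta; lra|].
      intros t Ht; apply Rlt_le, beta_integrand_pos; lra. }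
    pose proof (Q a' a ltac:(lra) ltac:(lra)). pose proof (Q b b' ltac:(lra) ltac:(lra)).
    unfold plus; simpl; lra.
  - exists L. intros P HP. specialize (HL P HP). unfold filtermap in HL.
    unfold filtermapi.
    assert (H0 : filter_prod (at_right 0) (Rbar_locally p_infty)
      (fun ab : R * R => 0 < fst ab /\ 0 < snd ab)).
    { apply (filter_prod_0_infty _ 1 1); simpl; intros; lra. }
    eapply filter_imp; [|exact (filter_and _ _ HL H0)].
    intros [a b] [H [Ha Hb]]; simpl in *.
    eexists; split; [|exact H].
    apply (RInt_correct (V := R_CompleteNormedModule)), ex_RInt_beta; assumption.
Qed.

Lemma beta_integral s k : 0 < s -> s < INR k ->
  is_RInt_gen (beta_integrand s k) (at_right 0) (Rbar_locally p_infty) (beta s (INR k - s)).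
Proof.
  intros Hs Hk. destruct (beta_integral_exists s k Hs Hk) as [l Hl].
  replace (beta s (INR k - s)) with l; [exact Hl|].
  symmetry; apply is_RInt_gen_unique.
  eapply is_RInt_gen_ext; [|exact Hl].
  apply (filter_prod_0_infty _ 1 1); [lra|]; simpl; intros a b Ha Hb t Ht.
  rewrite Rmin_left, Rmax_right in Ht by lra.
  unfold beta_integrand.
  replace (s + (INR k - s)) with (INR k) by ring.
  rewrite Rpower_pow by lra; reflexivity.
Qed.

Lemma filter_prod_rescale (lam : R) (P : R * R -> Prop) : 0 < lam ->
  filter_prod (at_right 0) (Rbar_locally p_infty) P ->
  filter_prod (at_right 0) (Rbar_locally p_infty)
    (fun ab => P (/ lam * fst ab, / lam * snd ab)).
Proof.
  intros Hl [Q S HQ [b0 HS] H].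
  apply at_right_0_iff in HQ as (a0 & Ha0 & HQ).
  assert (Hil : 0 < / lam) by (apply Rinv_0_lt_compat; exact Hl).
  apply (filter_prod_0_infty _ (lam * a0) (lam * b0)).
  - apply Rmult_lt_0_compat; assumption.
  - simpl; intros a b Ha Hb; apply H.
    + apply HQ; split; [apply Rmult_lt_0_compat; lra|].
      replace a0 with (/ lam * (lam * a0)) by (field; lra).
      apply Rmult_lt_compat_l; lra.
    + apply HS. replace b0 with (/ lam * (lam * b0)) by (field; lra).
      apply Rmult_lt_compat_l; lra.
Qed.

(** Balakrishnan's formula for a positive number, by the substitution [t = lam u]. *)
Lemma balakrishnan_integral_scalar s k lam : 0 < s -> s < INR k -> 0 < lam ->
  is_RInt_gen (fun t => Rpower t (s - 1) * (lam / (t + lam)) ^ k)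
    (at_right 0) (Rbar_locally p_infty) (Rpower lam s * beta s (INR k - s)).
Proof.
  intros Hs Hk Hl.
  apply is_RInt_gen_ext with
    (fun t => scal (Rpower lam s) (scal (/ lam) (beta_integrand s k (/ lam * t + 0)))).
  - apply (filter_prod_0_infty _ 1 1); [lra|]; simpl; intros a b Ha Hb t Ht.
    rewrite Rmin_left, Rmax_right in Ht by lra.
    unfold scal; simpl; unfold mult; simpl; unfold beta_integrand.
    rewrite Rplus_0_r, <- Rpower_mult_distr by (try apply Rinv_0_lt_compat; lra).
    replace (1 + / lam * t) with (/ (lam / (t + lam))) by (field; lra).
    rewrite pow_inv; unfold Rdiv at 1; rewrite Rinv_inv.
    replace (Rpower (/ lam) (s - 1)) with (lam * / Rpower lam s).
    + field; split; [apply Rgt_not_eq, exp_pos|lra].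
    + replace (/ lam) with (Rpower lam (Ropp 1))
        by (rewrite Rpower_Ropp, Rpower_1; [reflexivity|exact Hl]).
      rewrite Rpower_mult. replace (Ropp 1 * (s - 1)) with (1 + - s) by ring.
      rewrite Rpower_plus, Rpower_1, Rpower_Ropp by exact Hl. reflexivity.
  - apply (is_RInt_gen_scal (V := R_NormedModule)).
    intros P HP. pose proof (beta_integral s k Hs Hk P HP) as H.
    apply (filter_prod_rescale lam) in H; [|exact Hl].
    unfold filtermapi in *. eapply filter_imp; [|exact H].
    intros [a b] [y [Hy Py]]; simpl in *; exists y; split; [|exact Py].
    apply (is_RInt_comp_lin (V := R_NormedModule)). rewrite !Rplus_0_r; exact Hy.
Qed.

Lemma Riemann_sum_scal_vector {V : NormedModule R_AbsRing} (f : R -> R) (v : V) ptd :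
  Riemann_sum (fun t => scal (f t) v) ptd = scal (Riemann_sum f ptd) v.
Proof.
  unfold Riemann_sum. generalize (SF_h ptd, @zero R_AbelianMonoid); revert ptd.
  intros ptd; generalize (SF_t ptd) as l.
  induction l as [|h l IH]; intros p; simpl.
  - symmetry; apply (scal_zero_l v).
  - rewrite IH, (scal_distr_r (V := V) (K := R_AbsRing)), scal_assoc; reflexivity.
Qed.

Lemma is_RInt_gen_scal_vector {V : NormedModule R_AbsRing} (f : R -> R) (v : V) Fa Fb
  (FFa : Filter Fa) (FFb : Filter Fb) (l : R) :
  is_RInt_gen f Fa Fb l -> is_RInt_gen (fun t => scal (f t) v) Fa Fb (scal l v).
Proof.
  intros H P HP.
  assert (C : forall l : R_UniformSpace,
    filterlim (fun x : R => scal x v) (locally l) (locally (scal l v))).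
  { intros x; apply (filterlim_scal_l (K := R_AbsRing) (V := V) x v). }
  pose proof (H _ (C l P HP)) as H'. unfold filtermapi in *.
  eapply filter_imp; [|exact H']. intros [a b] [y [Hy Py]]; simpl in *.
  exists (scal y v); split; [|exact Py].
  unfold is_RInt in *.
  eapply filterlim_ext; [|exact (filterlim_comp _ _ _ _ _ _ _ _ Hy (C y))].
  intros ptd; simpl. rewrite Riemann_sum_scal_vector.
  rewrite scal_assoc; reflexivity.
Qed.

(** * Fractional powers of a diagonal operator *)

Section FractionalPower.
Context (lam : nat -> R) (Hpos : forall n, 0 < lam n) (Hlam : diverging lam).

(** The resolvent [(t + A)^{-1}] of the diagonal operator [A]. *)
Definition diag_resolvent (t : R) : c0_space -> c0_space :=
  mulop (fun n => (/ (RtoC t + RtoC (lam n)))%C).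

Lemma shift_neq0 t n : 0 < t -> (RtoC t + RtoC (lam n))%C <> RtoC 0.
Proof.
  intros Ht E; rewrite <- RtoC_plus in E; apply RtoC_inj in E.
  specialize (Hpos n); lra.
Qed.

(** The operator [A (t + A)^{-1}] multiplies by [lam / (t + lam)]. *)
Lemma term_iter_yosida t k x n : 0 < t ->
  term (Nat.iter k (fun v : c0_space =>
    minus v (scal (RtoC t : C_AbsRing) (diag_resolvent t v))) x) n
  = (RtoC ((lam n / (t + lam n)) ^ k) * term x n)%C.
Proof.
  intros Ht.
  set (f := fun v : c0_space => minus v (scal (RtoC t : C_AbsRing) (diag_resolvent t v))).
  induction k as [|k IH].
  - simpl; ring.
  - change (term (f (Nat.iter k f x)) n
      = (RtoC (lam n / (t + lam n) * (lam n / (t + lam n)) ^ k) * term x n)%C).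
    unfold f at 1, diag_resolvent; rewrite term_minus, term_scal, term_mulop.
    2: { apply bounded_inverse_shift; [exact Hlam|]. intros j; apply shift_neq0, Ht. }
    rewrite IH, RtoC_mult, RtoC_div, RtoC_plus by (specialize (Hpos n); lra).
    field. apply shift_neq0, Ht.
Qed.

Lemma pow_op_trunc N x k : dom (pow_op c0_space (diag lam) k) (trunc N x).
Proof.
  assert (V : forall j, vanishing (fun n => RtoC (lam n ^ j) * term (trunc N x) n)%C).
  { intros j; apply (vanishing_finite _ N); intros n Hn. rewrite term_trunc.
    destruct (Nat.ltb_spec n N); [lia|ring]. }
  exists (c0_of (fun n => RtoC (lam n ^ k) * term (trunc N x) n)%C).
  induction k as [|k IH].
  - apply c0_ext; intros n. rewrite (term_c0_of _ n (V 0%nat)). simpl; ring.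
  - refine (ex_intro _ _ (conj IH _)). intros n.
    rewrite (term_c0_of _ n (V (S k))), (term_c0_of _ n (V k)).
    simpl; rewrite RtoC_mult; ring.
Qed.

(** On finitely supported vectors Balakrishnan's integral is a finite sum of scalar
    integrals times coordinate vectors. *)
Lemma balakrishnan_integral_trunc s k N (x y : c0_space) : 0 < s -> s < INR k ->
  (forall n, term y n = (RtoC (Rpower (lam n) s) * term x n)%C) ->
  is_RInt_gen (V := restrict_scalars c0_space)
    (fun t => scal (RtoC (Rpower t (s - 1)) : C_AbsRing)
      (Nat.iter k (fun v : c0_space =>
         minus v (scal (RtoC t : C_AbsRing) (diag_resolvent t v))) (trunc N x)))
    (at_right 0) (Rbar_locally p_infty)
    (scal (RtoC (beta s (INR k - s)) : C_AbsRing) (trunc N y)).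
Proof.
  intros Hs Hk Hy.
  set (g := fun (t : R) (n : nat) => Rpower t (s - 1) * (lam n / (t + lam n)) ^ k).
  set (e := fun n => c0_of (fun j => if (j =? n)%nat then term x n else RtoC 0)).
  assert (He : forall n j, term (e n) j = if (j =? n)%nat then term x n else RtoC 0).
  { intros n j; apply term_c0_of, (vanishing_finite _ (S n)).
    intros i Hi; destruct (Nat.eqb_spec i n); [lia|reflexivity]. }
  assert (V : forall t M, vanishing (fun n => RtoC (g t n) * term (trunc M x) n)%C).
  { intros t M; apply (vanishing_finite _ M); intros n Hn. rewrite term_trunc.
    destruct (Nat.ltb_spec n M); [lia|ring]. }
  eapply is_RInt_gen_ext with
    (f := fun t => c0_of (fun n => RtoC (g t n) * term (trunc N x) n)%C).
  { apply (filter_prod_0_infty _ 1 1); [lra|]; simpl; intros a b Ha Hb t Ht.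
    rewrite Rmin_left, Rmax_right in Ht by lra.
    apply c0_ext; intros n.
    rewrite (term_c0_of _ n (V t N)), term_scal, term_iter_yosida by lra.
    unfold g; rewrite RtoC_mult; ring. }
  clear - g e He V Hs Hk Hy Hpos.
  induction N as [|N IH].
  - pose proof (is_RInt_gen_scal_vector (V := restrict_scalars c0_space) (fun t => g t 0%nat)
      (zero : c0_space) _ _ _ _ _
      (balakrishnan_integral_scalar s k (lam 0%nat) Hs Hk (Hpos 0%nat)))
      as H.
    set (I0 := Rpower (lam 0%nat) s * beta s (INR k - s)) in *.
    replace (scal (RtoC (beta s (INR k - s)) : C_AbsRing) (trunc 0 y))
      with (scal (RtoC I0 : C_AbsRing) (zero : c0_space)).
    + eapply is_RInt_gen_ext; [|exact H].
      apply filter_forall; intros ab t _. apply c0_ext; intros n.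
      rewrite (term_c0_of _ n (V t 0%nat)), term_trunc.
      change (RtoC (g t 0%nat) * RtoC 0 = RtoC (g t n) * RtoC 0)%C. ring.
    + apply c0_ext; intros n. rewrite !term_scal, term_trunc, term_zero. simpl. ring.
  - pose proof (is_RInt_gen_scal_vector (V := restrict_scalars c0_space) (fun t => g t N)
      (e N) _ _ _ _ _ (balakrishnan_integral_scalar s k (lam N) Hs Hk (Hpos N)))
      as H.
    set (IN := Rpower (lam N) s * beta s (INR k - s)) in *.
    pose proof (is_RInt_gen_plus (V := restrict_scalars c0_space) _ _ _ _ IH H) as H'.
    match type of H' with is_RInt_gen _ _ _ ?z =>
      replace (scal (RtoC (beta s (INR k - s)) : C_AbsRing) (trunc (S N) y)) with z end.
    + eapply is_RInt_gen_ext; [|exact H'].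
      apply filter_forall; intros ab t _. apply c0_ext; intros n.
      rewrite (term_c0_of _ n (V t (S N))), term_trunc.
      change (term (c0_of (fun n => RtoC (g t n) * term (trunc N x) n)%C) n
        + RtoC (g t N) * term (e N) n
        = RtoC (g t n) * (if (n <? S N)%nat then term x n else RtoC 0))%C.
      rewrite (term_c0_of _ n (V t N)), term_trunc, He.
      destruct (Nat.ltb_spec n N), (Nat.ltb_spec n (S N)), (Nat.eqb_spec n N); try lia;
        try subst n; ring.
    + apply c0_ext; intros n.
      change (RtoC (beta s (INR k - s)) * term (trunc N y) n + RtoC IN * term (e N) n
        = RtoC (beta s (INR k - s)) * term (trunc (S N) y) n)%C.
      rewrite !term_trunc, He.
      destruct (Nat.ltb_spec n N), (Nat.ltb_spec n (S N)), (Nat.eqb_spec n N); try lia;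
        try subst n; try ring.
      rewrite Hy; unfold IN; rewrite RtoC_mult; ring.
Qed.

(** Truncations of [x] lie in the domain of every power of [A]; both they and their
    images converge. *)
Lemma diag_frac_power s (x y : c0_space) : 0 < s ->
  (forall n, term y n = (RtoC (Rpower (lam n) s) * term x n)%C) ->
  frac_power (diag lam) s x y.
Proof.
  intros Hs Hy. right; split; [exact Hs|]. intros eps.
  destruct (trunc_close x eps (cond_pos eps)) as [N1 H1].
  destruct (trunc_close y eps (cond_pos eps)) as [N2 H2].
  exists (trunc (Nat.max N1 N2) x), (trunc (Nat.max N1 N2) y).
  split; [apply H1, Nat.le_max_l|]. split; [apply H2, Nat.le_max_r|].
  destruct (nfloor_ex s (Rlt_le _ _ Hs)) as [k Hk].
  exists (S k), diag_resolvent. rewrite S_INR.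
  split; [lra|]. split; [apply pow_op_trunc|]. split.
  - intros t Ht; apply diag_shift_inverse; [exact Hlam|]. intros n; apply shift_neq0, Ht.
  - rewrite <- S_INR. apply balakrishnan_integral_trunc;
      [exact Hs|rewrite S_INR; lra|exact Hy].
Qed.
End FractionalPower.

(** * The rational calculus of a diagonal operator *)

Lemma diag_scal_op lam a : a <> 0 ->
  scal_op (RtoC a) (diag lam) = diag (fun k => a * lam k).
Proof.
  intros Ha; apply functional_extensionality; intros x.
  apply functional_extensionality; intros y. apply propositional_extensionality; split.
  - intros (w & Hw & ->) n. rewrite term_scal, Hw, RtoC_mult; ring.
  - intros H. exists (scal (RtoC (/ a) : C_AbsRing) y); split.
    + intros n. rewrite term_scal, H, RtoC_mult, RtoC_inv by exact Ha.
      field. intros E; apply Ha, RtoC_inj, E.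
    + apply c0_ext; intros n. rewrite !term_scal, RtoC_inv by exact Ha.
      field. intros E; apply Ha, RtoC_inj, E.
Qed.

Lemma Cpow_inv_l (z : C) k : z <> RtoC 0 -> Cpow (/ z) k = (/ Cpow z k)%C.
Proof.
  intros Hz; induction k as [|k IH]; simpl.
  - field.
  - rewrite IH. field. split; [apply Cpow_nz|]; exact Hz.
Qed.

(** The partial fractions are evaluated coordinatewise; the poles of [r] are not
    positive reals, so that all resolvents involved exist. *)
Lemma diag_rational_calculus (r : ratfun) lam :
  (forall x, 0 < x -> ~ is_pole r (RtoC x) /\ Cmod (reval r (RtoC x)) <= 1) ->
  (forall n, 0 < lam n) -> diverging lam ->
  is_rational_calculus r (diag lam) (mulop (fun k => reval r (RtoC (lam k)))).
Proof.
  intros Hr Hpos Hlam.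
  destruct (partial_fraction_exists r 1 Hr) as (c & l & Hpf & Hl).
  set (S := fun p : C => mulop (fun n => (/ (- p + RtoC (lam n)))%C)).
  assert (Hne : forall p n, is_pole r p -> (- p + RtoC (lam n))%C <> RtoC 0).
  { intros p n Hp E. apply (proj1 (Hr (lam n) (Hpos n))).
    replace (RtoC (lam n)) with p; [exact Hp|].
    replace p with (RtoC (lam n) - (- p + RtoC (lam n)))%C by ring. rewrite E; ring. }
  exists c, l, S; split; [exact Hpf|]. split.
  - intros u Hu; apply diag_shift_inverse; [exact Hlam|]. intros n; apply Hne, Hl, Hu.
  - intros x; apply c0_ext; intros n.
    assert (Hb : bounded_seq (fun k => reval r (RtoC (lam k)))).
    { exists 1; intros k; apply Hr, Hpos. }
    rewrite term_mulop by exact Hb. rewrite Hpf.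
    + clear Hpf. induction l as [|u l IH]; cbn [fold_right].
      * rewrite term_scal; reflexivity.
      * rewrite term_plus, <- IH by (intros v Hv; apply Hl; right; exact Hv).
        rewrite term_scal. unfold S at 1; rewrite mulop_iter.
        2: { apply bounded_inverse_shift; [exact Hlam|].
             intros k; apply Hne, Hl; left; reflexivity. }
        rewrite Cpow_inv_l by (apply Hne, Hl; left; reflexivity).
        unfold sf_eval.
        replace (RtoC (lam n) - pole u)%C with (- pole u + RtoC (lam n))%C by ring.
        unfold Cdiv; ring.
    + apply Hr, Hpos.
    + intros u Hu E. apply (Hne (pole u) n (Hl u Hu)). rewrite E; ring.
Qed.

(** * Stable rational functions at high frequencies *)

Lemma value_at_infinity_unique r c d :
  value_at_infinity r c -> value_at_infinity r d -> c = d.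
Proof.
  intros Hc Hd. apply NNPP; intros E.
  apply Cminus_neq0, Cmod_gt_0 in E. set (e := Cmod (c - d)%C) in *.
  assert (H : forall a, value_at_infinity r a -> exists M, forall z, M < Cmod z ->
    Cmod (reval r z - a)%C < e / 2).
  { intros a Ha.
    apply (Ha (fun w => Cmod (w - a)%C < e / 2)).
    assert (He : 0 < e / 2) by lra.
    apply (locally_le_locally_norm (K := C_AbsRing) (V := C_NormedModule)).
    exists (mkposreal _ He). intros w Hw; exact Hw. }
  destruct (H c Hc) as [M HM], (H d Hd) as [N HN].
  set (x := Rmax (Rmax M N) 0 + 1).
  pose proof (Rmax_l (Rmax M N) 0). pose proof (Rmax_r (Rmax M N) 0).
  pose proof (Rmax_l M N). pose proof (Rmax_r M N).
  assert (Hx : Cmod (RtoC x) = x) by (rewrite Cmod_R, Rabs_pos_eq; unfold x; lra).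
  specialize (HM (RtoC x)); specialize (HN (RtoC x)).
  rewrite Hx in HM, HN. specialize (HM ltac:(unfold x; lra)).
  specialize (HN ltac:(unfold x; lra)).
  pose proof (Cmod_triangle (reval r (RtoC x) - d)%C (- (reval r (RtoC x) - c))%C) as T.
  rewrite Cmod_opp in T.
  replace (reval r (RtoC x) - d + - (reval r (RtoC x) - c))%C with (c - d)%C in T by ring.
  fold e in T. lra.
Qed.

(** On large real numbers [|r(x)| >= |r(oo)| - O(x^(-m))], with [|r(oo)| = 1]. *)
Lemma stable_lower_bound psi m r rinf :
  A_stable_order psi m r -> value_at_infinity r rinf -> Cmod rinf = 1 ->
  exists Z c, 1 <= Z /\ 0 <= c /\
    forall x, Z <= x -> 1 - c / x ^ m <= Cmod (reval r (RtoC x)).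
Proof.
  intros (_ & _ & c & a & Hc & _ & K & M & HK) Hrinf Hmod.
  rewrite (value_at_infinity_unique r rinf c Hrinf Hc) in Hmod.
  exists (Rmax 1 (M + 1)), (Cmod a + Rabs K).
  split; [apply Rmax_l|].
  split; [apply Rplus_le_le_0_compat; [apply Cmod_ge_0|apply Rabs_pos]|].
  intros x Hx.
  assert (H1 : 1 <= x) by (eapply Rle_trans; [apply Rmax_l|exact Hx]).
  assert (HM : M + 1 <= x) by (eapply Rle_trans; [apply Rmax_r|exact Hx]).
  assert (Ex : Cmod (RtoC x) = x) by (rewrite Cmod_R, Rabs_pos_eq; lra).
  specialize (HK (RtoC x)); rewrite Ex in HK; specialize (HK ltac:(lra)).
  assert (Hxm : 1 <= x ^ m) by (apply pow_R1_Rle; exact H1).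
  assert (Hx0 : RtoC x <> RtoC 0) by (intros E; apply RtoC_inj in E; lra).
  set (w := reval r (RtoC x)) in *.
  assert (Ha : Cmod (a / Cpow (RtoC x) m)%C = Cmod a / x ^ m).
  { rewrite Cmod_div by (apply Cpow_nz; exact Hx0). rewrite Cmod_pow, Ex; reflexivity. }
  assert (HK' : K / x ^ (m + 1) <= Rabs K / x ^ m).
  { rewrite pow_add, pow_1. unfold Rdiv.
    apply Rle_trans with (Rabs K * / (x ^ m * x)).
    - apply Rmult_le_compat_r; [apply Rlt_le, Rinv_0_lt_compat; nra|apply Rle_abs].
    - apply Rmult_le_compat_l; [apply Rabs_pos|]. apply Rinv_le_contravar; nra. }
  assert (T : Cmod c <= Cmod w + Cmod (w - (c - a / Cpow (RtoC x) m))%C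
                        + Cmod (a / Cpow (RtoC x) m)%C).
  { rewrite <- (Cmod_opp (w - _)).
    replace c with (w + - (w - (c - a / Cpow (RtoC x) m)) + a / Cpow (RtoC x) m)%C
      at 1 by ring.
    eapply Rle_trans; [apply Cmod_triangle|].
    apply Rplus_le_compat_r, Cmod_triangle. }
  rewrite Hmod, Ha in T.
  replace ((Cmod a + Rabs K) / x ^ m) with (Cmod a / x ^ m + Rabs K / x ^ m)
    by (field; lra).
  lra.
Qed.

Lemma bernoulli_decreasing y n : 0 <= y <= 1 -> 1 - INR n * y <= (1 - y) ^ n.
Proof.
  intros Hy; induction n as [|n IH]; [simpl; lra|].
  rewrite S_INR; simpl.
  assert (H : 0 <= INR n) by apply pos_INR.
  assert ((1 - y) * (1 - INR n * y) <= (1 - y) * (1 - y) ^ n)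
    by (apply Rmult_le_compat_l; lra).
  assert (0 <= INR n * (y * y)) by (apply Rmult_le_pos; nra).
  nra.
Qed.

Lemma Rpower_ge_1 x p : 1 <= x -> 0 <= p -> 1 <= Rpower x p.
Proof.
  intros Hx Hp. rewrite <- (Rpower_O x) by lra. apply Rle_Rpower; lra.
Qed.

(** The frequencies at which [n] steps of the scheme keep half of the amplitude, while
    the exact flow keeps at most a quarter of it. *)
Lemma stable_step_gap r m Z c : (1 <= m)%nat -> 1 <= Z -> 0 <= c ->
  (forall x, Z <= x -> 1 - c / x ^ m <= Cmod (reval r (RtoC x))) ->
  exists kappa, 2 <= kappa /\ forall n, (1 <= n)%nat ->
    / 4 <= Cmod (RtoC (exp (- (kappa * Rpower (INR n) (1 + / INR m))))
             - Cpow (reval r (RtoC (kappa * Rpower (INR n) (/ INR m)))) n)%C.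
Proof.
  intros Hm HZ Hc Hr.
  (* [Z <= kappa] gives access to the lower bound on [r], [2 * c <= kappa] makes
     [c / z ^ m <= 1 / (2 n)], and [2 <= kappa] makes [exp (- kappa) <= 1 / 4]. *)
  set (kappa := Rmax Z (Rmax 2 (2 * c))).
  assert (K1 : Z <= kappa) by apply Rmax_l.
  assert (K2 : 2 <= kappa) by (eapply Rle_trans; [|apply Rmax_r]; apply Rmax_l).
  assert (K3 : 2 * c <= kappa) by (eapply Rle_trans; [|apply Rmax_r]; apply Rmax_r).
  exists kappa; split; [exact K2|]. intros n Hn.
  assert (HN : 1 <= INR n) by (apply (le_INR 1), Hn).
  assert (HM : 1 <= INR m) by (apply (le_INR 1), Hm).
  assert (HiM : 0 < / INR m) by (apply Rinv_0_lt_compat; lra).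
  set (z := kappa * Rpower (INR n) (/ INR m)).
  assert (Hz : kappa <= z).
  { unfold z. pose proof (Rpower_ge_1 (INR n) (/ INR m) HN ltac:(lra)). nra. }
  assert (Hzm : 2 * c * INR n <= z ^ m).
  { unfold z. rewrite Rpow_mult_distr, <- (Rpower_pow m (Rpower _ _)) by apply exp_pos.
    rewrite Rpower_mult, Rinv_l, Rpower_1 by lra.
    apply Rmult_le_compat_r; [lra|]. apply Rle_trans with kappa; [exact K3|].
    destruct m as [|m']; [lia|]. simpl.
    assert (1 <= kappa ^ m') by (apply pow_R1_Rle; lra). nra. }
  assert (Hzm0 : 0 < z ^ m) by (apply pow_lt; lra).
  specialize (Hr z ltac:(lra)).
  assert (Hy : c / z ^ m <= / (2 * INR n)).
  { apply Rle_div_l; [exact Hzm0|].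
    apply Rmult_le_reg_l with (2 * INR n); [lra|].
    rewrite <- Rmult_assoc, Rinv_r, Rmult_1_l by lra. lra. }
  set (y := / (2 * INR n)) in *.
  assert (Hny : INR n * y = / 2) by (unfold y; field; lra).
  assert (Hy0 : 0 <= y) by (apply Rlt_le, Rinv_0_lt_compat; lra).
  assert (Hy1 : y <= 1) by nra.
  assert (HP : / 2 <= Cmod (Cpow (reval r (RtoC z)) n)).
  { rewrite Cmod_pow. apply Rle_trans with ((1 - y) ^ n).
    - pose proof (bernoulli_decreasing y n ltac:(lra)). lra.
    - apply pow_incr; lra. }
  set (lam := kappa * Rpower (INR n) (1 + / INR m)).
  assert (Hlam : 2 <= lam).
  { unfold lam. pose proof (Rpower_ge_1 (INR n) (1 + / INR m) HN ltac:(lra)). nra. }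
  assert (HE : exp (- lam) <= / 4).
  { rewrite exp_Ropp. apply Rinv_le_contravar; [lra|].
    apply Rle_trans with (exp (1 + 1)).
    - rewrite exp_plus. pose proof (exp_ineq1_le 1). nra.
    - destruct Hlam as [L|L]; [apply Rlt_le, exp_increasing; lra|right; f_equal; lra]. }
  pose proof (Cmod_triangle (RtoC (exp (- lam)) - Cpow (reval r (RtoC z)) n)%C
    (- RtoC (exp (- lam)))%C) as T.
  replace (RtoC (exp (- lam)) - Cpow (reval r (RtoC z)) n + - RtoC (exp (- lam)))%C
    with (- Cpow (reval r (RtoC z)) n)%C in T by ring.
  rewrite !Cmod_opp, Cmod_R, Rabs_pos_eq in T by apply Rlt_le, exp_pos.
  lra.
Qed.

Lemma A_stable_positive_reals psi r : 0 < psi -> A_stable psi r ->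
  forall x, 0 < x -> ~ is_pole r (RtoC x) /\ Cmod (reval r (RtoC x)) <= 1.
Proof.
  intros Hpsi Hr x Hx; apply Hr. exists x, 0.
  split; [exact Hx|]. split; [rewrite Rabs_R0; exact Hpsi|].
  unfold polar, RtoC; rewrite cos_0, sin_0; f_equal; ring.
Qed.

Theorem theorem7p3 (psi : R) (m q : nat) (r : ratfun) (rinf : C)
  (Hpsi : 0 < psi <= PI / 2) (Hm : (1 <= m)%nat) (Hq : (1 <= q)%nat)
  (Hstable : A_stable_order psi m r)
  (Happrox : approx_exp_order q r)
  (Hrinf : value_at_infinity r rinf) (Hmod : Cmod rinf = 1) :
  forall theta : R, 0 <= theta < PI / 2 ->
  exists K : R, 0 < K /\
  forall alpha : nat -> R,
    (forall n : nat, (1 <= n)%nat -> 0 < alpha n) ->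
    is_lim_seq alpha 0 ->
  forall s : R, 0 <= s < INR m * INR q / (INR m + 1) ->
  exists (X : CompleteNormedModule C_AbsRing) (A : X -> X -> Prop) (x : X)
         (T : R -> X -> X) (rA : nat -> X -> X),
    Sect theta A /\
    dom (frac_power A s) x /\
    is_exp_semigroup A T /\
    (forall n : nat, (1 <= n)%nat ->
       is_rational_calculus r (scal_op (RtoC (/ INR n)) A) (rA n)) /\
    forall n : nat, (1 <= n)%nat ->
      norm (minus (T 1 x) (Nat.iter n (rA n) x)) >=
      K * alpha n * Rpower (INR n) (- ((1 + / INR m) * s)).
Proof.
  intros theta Htheta. exists (/ 4); split; [lra|].
  intros alpha Hapos Halpha s Hs.
  assert (Hreal := A_stable_positive_reals psi r (proj1 Hpsi) (proj1 (proj2 Hstable))).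
  destruct (stable_lower_bound psi m r rinf Hstable Hrinf Hmod) as (Z & c & HZ & Hc & HZc).
  destruct (stable_step_gap r m Z c Hm HZ Hc HZc) as (kappa & Hkappa & Hgap).
  assert (HM : 1 <= INR m) by (apply (le_INR 1), Hm).
  assert (HiM : 0 < / INR m) by (apply Rinv_0_lt_compat; lra).
  assert (HN : forall k, 1 <= INR (S k)) by (intros k; apply (le_INR 1); lia).
  (* The coordinate [k] serves the number of steps [n = S k]. *)
  set (lam := fun k => kappa * Rpower (INR (S k)) (1 + / INR m)).
  assert (Hpos : forall k, 0 < lam k).
  { intros k; apply Rmult_lt_0_compat; [lra|apply exp_pos]. }
  assert (Hge : forall k, INR (S k) <= lam k).
  { intros k; unfold lam. rewrite Rpower_plus, Rpower_1 by (specialize (HN k); lra).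
    pose proof (Rpower_ge_1 (INR (S k)) (/ INR m) (HN k) ltac:(lra)).
    specialize (HN k).
    assert (INR (S k) <= INR (S k) * Rpower (INR (S k)) (/ INR m)) by nra. nra. }
  assert (Hdiv : forall a, 0 < a -> diverging (fun k => a * lam k)).
  { intros a Ha B. destruct (INR_unbounded (B / a)) as [N HNB].
    exists N; intros k Hk. apply le_INR in Hk. specialize (Hge k).
    rewrite S_INR in Hge. apply Rmult_gt_compat_r with (r := a) in HNB; [|exact Ha].
    replace (B / a * a) with B in HNB by (field; lra). nra. }
  assert (Hlam : diverging lam).
  { replace lam with (fun k => 1 * lam k); [apply Hdiv; lra|].
    apply functional_extensionality; intros k; ring. }
  set (p := (1 + / INR m) * s).
  assert (Hp : 0 <= p) by (apply Rmult_le_pos; lra).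
  assert (Va : vanishing (fun k => RtoC (alpha (S k)))).
  { intros eps He. apply is_lim_seq_spec in Halpha.
    destruct (Halpha (mkposreal eps He)) as [N HNa]. exists N; intros k Hk.
    rewrite Cmod_R. specialize (HNa (S k) ltac:(lia)). simpl in HNa.
    rewrite Rminus_0_r in HNa; exact HNa. }
  set (xs := fun k => RtoC (alpha (S k) * Rpower (INR (S k)) (- p))).
  assert (Vx : vanishing xs).
  { apply (vanishing_le (fun k => RtoC (alpha (S k))) _ 1); [|exact Va].
    intros k; unfold xs. rewrite RtoC_mult, Cmod_mult, Rmult_comm.
    apply Rmult_le_compat_r; [apply Cmod_ge_0|].
    rewrite Cmod_R, Rabs_pos_eq by apply Rlt_le, exp_pos.
    rewrite Rpower_Ropp, <- Rinv_1. apply Rinv_le_contravar; [lra|].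
    apply Rpower_ge_1; auto. }
  set (x := C0 xs Vx).
  exists c0_space, (diag lam), x, (diag_exp lam),
    (fun n => mulop (fun k => reval r (RtoC (/ INR n * lam k)))).
  assert (Hn0 : forall n, (1 <= n)%nat -> 0 < / INR n).
  { intros n Hn; apply Rinv_0_lt_compat, lt_0_INR; lia. }
  split; [apply diag_Sect; auto; lra|].
  split; [|split; [apply diag_is_exp_semigroup; exact Hpos|split]].
  - destruct (Req_dec s 0) as [Hs0|Hs0].
    + exists x; left; auto.
    + (* the coordinates of [A^s x] *)
      set (ys := fun k => RtoC (Rpower kappa s * alpha (S k))).
      assert (Vy : vanishing ys).
      { unfold ys. replace (fun k => RtoC (Rpower kappa s * alpha (S k)))
          with (fun k => (RtoC (Rpower kappa s) * RtoC (alpha (S k)))%C).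
        - apply vanishing_scal, Va.
        - apply functional_extensionality; intros k; rewrite RtoC_mult; reflexivity. }
      exists (C0 ys Vy). apply diag_frac_power; auto; [lra|].
      intros k; simpl; unfold ys, xs. rewrite <- RtoC_mult; f_equal.
      unfold lam. rewrite <- Rpower_mult_distr by (try apply exp_pos; lra).
      rewrite Rpower_mult. fold p. rewrite Rpower_Ropp.
      field. apply Rgt_not_eq, exp_pos.
  - intros n Hn. rewrite diag_scal_op by (specialize (Hn0 n Hn); lra).
    apply diag_rational_calculus; [exact Hreal| |apply Hdiv, Hn0, Hn].
    intros k; apply Rmult_lt_0_compat; [apply Hn0, Hn|apply Hpos].
  - intros n Hn. apply Rle_ge.
    destruct n as [|k]; [lia|].
    eapply Rle_trans; [|apply (norm_ge_term _ k)].
    rewrite term_minus, term_diag_exp by (auto; lra).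
    rewrite mulop_iter.
    2: { exists 1; intros j. apply Hreal.
         apply Rmult_lt_0_compat; [apply Hn0, Hn|apply Hpos]. }
    replace (/ INR (S k) * lam k) with (kappa * Rpower (INR (S k)) (/ INR m)).
    2: { specialize (HN k). unfold lam. rewrite Rpower_plus, Rpower_1 by lra. field; lra. }
    rewrite Rmult_1_l. unfold lam.
    specialize (Hgap (S k) Hn).
    match goal with |- _ <= Cmod (?a * ?b - ?d * ?b)%C =>
      replace (a * b - d * b)%C with ((a - d) * b)%C by ring end.
    rewrite Cmod_mult, Rmult_assoc. apply Rmult_le_compat; [lra| |exact Hgap|].
    + apply Rmult_le_pos; [apply Rlt_le, Hapos, Hn|apply Rlt_le, exp_pos].
    + change (term x k) with (xs k). unfold xs. rewrite Cmod_R.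
      fold p. apply Rle_abs.
Qed.
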